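(* Let $\mathcal H_v=(\mathbb C^2)^{\otimes n_v}$ and $\mathcal H_h=(\mathbb C^2)^{\otimes n_h}$, and let $H=H(\theta)$ be a Hermitian operator on $\mathcal H_v\otimes\mathcal H_h$ depending differentiably on a real parameter $\theta$. Let $\sigma_v=\sigma_v(\theta)=\mathrm{Tr}_h\left[e^{-H}/\mathrm{Tr}[e^{-H}]\right]$ be the state on the visible units of the quantum Boltzmann machine with Hamiltonian $H$, and let $\rho$ be a density operator on $\mathcal H_v$. Then $$\partial_\theta\widetilde D_2(\rho\|\sigma_v(\theta))=\sum_{p=0}^\infty\frac{\mathrm{Tr}\left(\rho^2\sigma_v^{-1}(\theta)\,\mathrm{Tr}_h\left(\mathrm{Ad}^p_{-H}(\partial_\theta H)\,e^{-H}\right)\sigma_v^{-1}(\theta)\right)}{\mathrm{Tr}(\rho^2\sigma_v^{-1})\,\mathrm{Tr}(e^{-H(\theta)})\,(p+1)!}-\frac{\mathrm{Tr}\left((\partial_\theta H(\theta))e^{-H(\theta)}\right)}{\mathrm{Tr}(e^{-H(\theta)})},$$ and, if $\rho$ is invertible, for the reverse divergence $$\partial_\theta\widetilde D_2(\sigma_v(\theta)\|\rho)=-\sum_{p=0}^\infty\frac{\mathrm{Tr}\left(\mathrm{Ad}^p_{-H}(\partial_\theta H)\,e^{-H}\,\left(\{\sigma_v(\theta),\rho^{-1}\}\otimes I_h\right)\right)}{\mathrm{Tr}(\sigma_v^2\rho^{-1})\,\mathrm{Tr}(e^{-H(\theta)})\,(p+1)!}+2\,\frac{\mathrm{Tr}\left((\partial_\theta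 H(\theta))e^{-H(\theta)}\right)}{\mathrm{Tr}(e^{-H(\theta)})}.$$
   Context: A density operator is a positive semidefinite matrix of trace one. $\mathrm{Tr}_h$ is the partial trace over $\mathcal H_h$ and $I_h$ the identity on $\mathcal H_h$. $\mathrm{Ad}_H(A)=[H,A]=HA-AH$, and $\mathrm{Ad}^p_H$ is its $p$-fold iterate ($\mathrm{Ad}^0_H(A)=A$). $\{A,B\}=AB+BA$. The maximal R\'enyi divergence of order two is $\widetilde D_2(\rho\|\sigma)=\log\mathrm{Tr}(\rho^2\sigma^{-1})$ (natural logarithm), where the second argument is invertible. *)

(* Defs.v *)
From HB Require Import structures.
From mathcomp Require Import all_boot all_order all_algebra.
From mathcomp Require Import sesquilinear spectral complex mxtens.
From mathcomp Require Import all_classical all_reals all_analysis.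

Set Implicit Arguments.
Unset Strict Implicit.
Unset Printing Implicit Defensive.

Import Order.TTheory GRing.Theory Num.Theory.
Import numFieldNormedType.Exports.

Local Open Scope classical_set_scope.
Local Open Scope ring_scope.
Local Open Scope complex_scope.

(* R[i] as a numClosedFieldType: as such (but not as a bare R[i]) it carries the
   topology of its modulus, and complex matrices the entrywise topology. *)
Definition Cx (R : realType) : numClosedFieldType := R[i].

(* For z : C, 0 <= z means that z is real and nonnegative, so this condition on
   the quadratic form also forces A to be Hermitian. *)
Definition psdmx (C : numClosedFieldType) n (A : 'M[C]_n) : Prop :=
  forall u : 'cV[C]_n, 0 <= ((u ^t*)%sesqui *m A *m u) 0 0.

Definition density (C : numClosedFieldType) n (A : 'M[C]_n) : Prop :=
  psdmx A /\ \tr A = 1.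

Definition expm (C : numClosedFieldType) n (A : 'M[C]_n) : 'M[C]_n :=
  limn (series (fun k => k`!%:R^-1 *: A ^+ k)).

Definition Ad (C : numClosedFieldType) n (A B : 'M[C]_n) : 'M[C]_n :=
  A *m B - B *m A.

Definition anticomm (C : numClosedFieldType) n (A B : 'M[C]_n) : 'M[C]_n :=
  A *m B + B *m A.

(* Partial trace over the second factor, in the basis ordering of the Kronecker
   product *t, where e_i (x) e_k has index mxtens_index (i, k). *)
Definition ptrace2 (C : numClosedFieldType) m n (A : 'M[C]_(m * n)) : 'M[C]_m :=
  \matrix_(i, j) \sum_(k < n) A (mxtens_index (i, k)) (mxtens_index (j, k)).

Definition visible_state (C : numClosedFieldType) m n (H : 'M[C]_(m * n)) :
    'M[C]_m :=
  ptrace2 ((\tr (expm (- H)))^-1 *: expm (- H)).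

(* The trace is a real number for density operators rho and sigma. *)
Definition renyi2 (R : realType) n (rho sigma : 'M[Cx R]_n) : R :=
  ln (complex.Re (\tr (rho *m rho *m invmx sigma))).

Definition mxderivable (R : realType) m n (F : R -> 'M[Cx R]_(m, n)) (t : R) :
    Prop :=
  forall i j, derivable (fun s => complex.Re (F s i j)) t 1 /\
              derivable (fun s => complex.Im (F s i j)) t 1.

Definition mxderive (R : realType) m n (F : R -> 'M[Cx R]_(m, n)) (t : R) :
    'M[Cx R]_(m, n) :=
  \matrix_(i, j) ('D_1 (fun s => complex.Re (F s i j)) t +i*
                  'D_1 (fun s => complex.Im (F s i j)) t).

(* Main.v *)
(** Termwise differentiation of the exponential series shows that exp is
    differentiable at X, with derivative in the direction V equal to
    sum_k 1/k! sum_(i<k) X^i V X^(k-1-i).  Commuting the powers of X to the right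
    with X^i V = sum_j C(i,j) Ad_X^j(V) X^(i-j) rewrites the inner sum as
    sum_(j<k) C(k,j+1) Ad_X^j(V) X^(k-1-j), so the derivative is the Cauchy product
    Phi(V) e^X with Phi(V) = sum_p Ad_X^p(V) / (p+1)!; its trace is Tr(V e^X).
    With P = Tr_h e^(-H) and Z = Tr e^(-H) one has sigma = P / Z, hence
    D_2(rho || sigma) = ln Tr(rho^2 P^-1) + ln Z and
    D_2(sigma || rho) = ln Tr(P^2 rho^-1) - 2 ln Z, and only P, its inverse and
    Z need to be differentiated.  All the logarithms have positive arguments
    because e^(-H), and therefore P, is positive definite. *)
From HB Require Import structures.
Require Import Defs.
From mathcomp Require Import all_boot all_order all_algebra.
From mathcomp Require Import sesquilinear spectral complex mxtens.
From mathcomp Require Import all_classical all_reals all_analysis.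
From mathcomp Require Import ring lra.

Import Order.TTheory GRing.Theory Num.Theory.
Import numFieldNormedType.Exports.

Local Open Scope classical_set_scope.
Local Open Scope ring_scope.
Local Open Scope complex_scope.
Set Implicit Arguments.
Unset Strict Implicit.
Unset Printing Implicit Defensive.

(** * A submultiplicative real-valued norm on complex matrices *)

Section Modulus.
Context {R : realType}.
Implicit Types z w : Cx R.

(** The modulus [|z|] is itself an element of [Cx R]; its real part puts all estimates in [R], where
    real limits and the real exponential series live. *)
Definition cabs z : R := complex.Re `|z|.

Lemma cabsE z : (cabs z)%:C = `|z|.
Proof. by rewrite /cabs RRe_real ?normr_real. Qed.

Lemma cabs_ge0 z : 0 <= cabs z.
Proof. by rewrite -lecR cabsE normr_ge0. Qed.

Lemma cabs0 : cabs 0 = 0.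
Proof. by rewrite /cabs normr0. Qed.

Lemma cabsM z w : cabs (z * w) = cabs z * cabs w.
Proof. by apply: complexI; rewrite rmorphM !cabsE normrM. Qed.

Lemma cabsD z w : cabs (z + w) <= cabs z + cabs w.
Proof. by rewrite -lecR rmorphD !cabsE ler_normD. Qed.

Lemma cabsN z : cabs (- z) = cabs z.
Proof. by rewrite /cabs normrN. Qed.

Lemma cabsJ z : cabs z^* = cabs z.
Proof. by rewrite /cabs norm_conjC. Qed.

Lemma cabs_real (x : R) : cabs x%:C = `|x|.
Proof. by rewrite /cabs normc_def /= expr0n addr0 sqrtr_sqr. Qed.

Lemma cabs0_eq0 z : cabs z = 0 -> z = 0.
Proof. by move=> z0; apply/eqP; rewrite -normr_eq0 -cabsE z0. Qed.

Lemma cabs_defE z : cabs z = Num.sqrt (complex.Re z ^+ 2 + complex.Im z ^+ 2).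
Proof. by rewrite /cabs normc_def. Qed.

Lemma normr_Re_le z : `|complex.Re z| <= cabs z.
Proof. by rewrite cabs_defE -sqrtr_sqr; apply: ler_wsqrtr; rewrite lerDl sqr_ge0. Qed.

Lemma normr_Im_le z : `|complex.Im z| <= cabs z.
Proof. by rewrite cabs_defE -sqrtr_sqr; apply: ler_wsqrtr; rewrite lerDr sqr_ge0. Qed.

Lemma cabs_le_ReIm z : cabs z <= `|complex.Re z| + `|complex.Im z|.
Proof.
rewrite cabs_defE -[leRHS]ger0_norm ?addr_ge0 // -[leRHS]sqrtr_sqr; apply: ler_wsqrtr.
rewrite sqrrD !real_normK ?num_real // addrAC lerDl.
by rewrite mulrn_wge0 // mulr_ge0.
Qed.

Lemma cabs_sum (I : Type) (r : seq I) (P : pred I) (F : I -> Cx R) :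
  cabs (\sum_(i <- r | P i) F i) <= \sum_(i <- r | P i) cabs (F i).
Proof.
elim/big_rec2: _ => [|i y x _ le_xy]; first by rewrite cabs0.
by apply: le_trans (cabsD _ _) _; rewrite lerD2l.
Qed.

Lemma ReD z w : complex.Re (z + w) = complex.Re z + complex.Re w.
Proof. by case: z; case: w. Qed.
Lemma ImD z w : complex.Im (z + w) = complex.Im z + complex.Im w.
Proof. by case: z; case: w. Qed.
Lemma ReN z : complex.Re (- z) = - complex.Re z.
Proof. by case: z. Qed.
Lemma ImN z : complex.Im (- z) = - complex.Im z.
Proof. by case: z. Qed.
Lemma Re_realM (x : R) z : complex.Re (x%:C * z) = x * complex.Re z.
Proof. by case: z => a b /=; rewrite mul0r subr0. Qed.
Lemma Im_realM (x : R) z : complex.Im (x%:C * z) = x * complex.Im z.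
Proof. by case: z => a b /=; rewrite mul0r addr0. Qed.

End Modulus.

Section Norm.
Context {R : realType}.
Local Notation C := (Cx R).

(** The entrywise l1 norm is submultiplicative with no dimension constant and dominates every entry
    and the trace. *)
Definition mxnorm1 {m n} (A : 'M[C]_(m, n)) : R := \sum_i \sum_j cabs (A i j).

Lemma mxnorm1_ge0 m n (A : 'M[C]_(m, n)) : 0 <= mxnorm1 A.
Proof. by do 2!apply: sumr_ge0 => ? _; apply: cabs_ge0. Qed.

Lemma cabs_le_mxnorm1 m n (A : 'M[C]_(m, n)) i j : cabs (A i j) <= mxnorm1 A.
Proof.
rewrite /mxnorm1 (bigD1 i) //= (bigD1 j) //= -addrA lerDl.
by rewrite addr_ge0 //; do ?[apply: sumr_ge0 => ? _]; apply: cabs_ge0.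
Qed.

Lemma mxnorm1_0 m n : mxnorm1 (0 : 'M[C]_(m, n)) = 0.
Proof.
by rewrite /mxnorm1 big1 // => i _; rewrite big1 // => j _; rewrite mxE cabs0.
Qed.

Lemma mxnorm1_eq0 m n (A : 'M[C]_(m, n)) : mxnorm1 A <= 0 -> A = 0.
Proof.
move=> A0; apply/matrixP => i j; rewrite mxE; apply: cabs0_eq0.
apply/le_anti; rewrite cabs_ge0 andbT.
exact: le_trans (cabs_le_mxnorm1 _ _ _) A0.
Qed.

Lemma mxnorm1D m n (A B : 'M[C]_(m, n)) :
  mxnorm1 (A + B) <= mxnorm1 A + mxnorm1 B.
Proof.
rewrite -big_split ler_sum // => i _; rewrite -big_split ler_sum // => j _.
by rewrite mxE cabsD.
Qed.

Lemma mxnorm1N m n (A : 'M[C]_(m, n)) : mxnorm1 (- A) = mxnorm1 A.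
Proof. by apply: eq_bigr => i _; apply: eq_bigr => j _; rewrite mxE cabsN. Qed.

Lemma mxnorm1B m n (A B : 'M[C]_(m, n)) :
  mxnorm1 (A - B) <= mxnorm1 A + mxnorm1 B.
Proof. by apply: le_trans (mxnorm1D _ _) _; rewrite mxnorm1N. Qed.

Lemma mxnorm1_distC m n (A B : 'M[C]_(m, n)) : mxnorm1 (A - B) = mxnorm1 (B - A).
Proof. by rewrite -mxnorm1N opprB. Qed.

Lemma mxnorm1Z m n a (A : 'M[C]_(m, n)) : mxnorm1 (a *: A) = cabs a * mxnorm1 A.
Proof.
rewrite mulr_sumr; apply: eq_bigr => i _; rewrite mulr_sumr.
by apply: eq_bigr => j _; rewrite mxE cabsM.
Qed.

Lemma mxnorm1_sum m n (I : Type) (r : seq I) (P : pred I) (F : I -> 'M[C]_(m, n)) :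
  mxnorm1 (\sum_(i <- r | P i) F i) <= \sum_(i <- r | P i) mxnorm1 (F i).
Proof.
elim/big_rec2: _ => [|i y x _ le_xy]; first by rewrite mxnorm1_0.
by apply: le_trans (mxnorm1D _ _) _; rewrite lerD2l.
Qed.

(** After exchanging the sums over j and k, each row sum of B is at most the full norm of B. *)
Lemma mxnorm1M m n p (A : 'M[C]_(m, n)) (B : 'M[C]_(n, p)) :
  mxnorm1 (A *m B) <= mxnorm1 A * mxnorm1 B.
Proof.
rewrite /mxnorm1 mulr_suml ler_sum // => i _; rewrite mulr_suml.
apply: (@le_trans _ _ (\sum_j \sum_k cabs (A i k) * cabs (B k j))).
  rewrite ler_sum // => j _; rewrite mxE; apply: le_trans (cabs_sum _ _ _) _.
  by rewrite ler_sum // => k _; rewrite cabsM.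
rewrite exchange_big ler_sum // => k _; rewrite -mulr_sumr ler_wpM2l ?cabs_ge0 //.
rewrite [leRHS](bigD1 k) //= lerDl.
by do 2!apply: sumr_ge0 => ? _; apply: cabs_ge0.
Qed.

Lemma mxnorm1_trC m n (A : 'M[C]_(m, n)) : mxnorm1 (A^t*)%sesqui = mxnorm1 A.
Proof.
rewrite [RHS]exchange_big; apply: eq_bigr => i _; apply: eq_bigr => j _.
by rewrite !mxE cabsJ.
Qed.

Lemma cabs_mxtrace_le n (A : 'M[C]_n) : cabs (\tr A) <= mxnorm1 A.
Proof.
apply: le_trans (cabs_sum _ _ _) _; apply: ler_sum => i _.
by rewrite (bigD1 i) //= lerDl sumr_ge0 // => j _; apply: cabs_ge0.
Qed.

(** Expanding A in matrix units bounds f by the total norm of the images of these units. *)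
Lemma linear_mxnorm1_bound m n p q (f : {linear 'M[C]_(m, n) -> 'M[C]_(p, q)}) :
  exists2 c : R, 0 <= c & forall A, mxnorm1 (f A) <= c * mxnorm1 A.
Proof.
exists (\sum_i \sum_j mxnorm1 (f (delta_mx i j))) => [|A].
  by do 2!apply: sumr_ge0 => ? _; apply: mxnorm1_ge0.
rewrite {1}[A]matrix_sum_delta linear_sum; apply: le_trans (mxnorm1_sum _ _ _) _.
rewrite mulr_suml ler_sum // => i _; rewrite linear_sum.
apply: le_trans (mxnorm1_sum _ _ _) _.
rewrite mulr_suml ler_sum // => j _; rewrite linearZ mxnorm1Z mulrC.
by rewrite ler_wpM2l ?mxnorm1_ge0 // cabs_le_mxnorm1.
Qed.

End Norm.

(** * Convergence of matrices in norm *)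

Section MatrixConvergence.
Context {R : realType}.
Local Notation C := (Cx R).

(** A real limit along an arbitrary filter: the same calculus serves series ([\oo]) and difference
    quotients (punctured neighbourhoods of 0). *)
Definition mxcvg {T : Type} (F : set_system T) {m n} (u : T -> 'M[C]_(m, n))
    (A : 'M[C]_(m, n)) :=
  mxnorm1 (u x - A) @[x --> F] --> (0 : R).

Section Filter.
Context {T : Type} {F : set_system T} {FF : Filter F}.

Lemma mxcvg_le m n (u : T -> 'M[C]_(m, n)) A (b : T -> R) :
  (\forall x \near F, mxnorm1 (u x - A) <= b x) -> b x @[x --> F] --> 0 ->
  mxcvg F u A.
Proof.
move=> ub b0; apply: (squeeze_cvgr _ (cvg_cst (0 : R)) b0).
by apply: filterS ub => x ->; rewrite mxnorm1_ge0.
Qed.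

Lemma cvg_sum0 (I : Type) (r : seq I) (f : I -> T -> R) :
  (forall i, f i x @[x --> F] --> (0 : R)) ->
  \sum_(i <- r) f i x @[x --> F] --> (0 : R).
Proof.
move=> f0; elim: r => [|i r IH].
  by under eq_fun do rewrite big_nil; apply: cvg_cst.
under eq_fun do rewrite big_cons.
by have := cvgD (f0 i) IH; rewrite addr0; apply.
Qed.

Lemma mxcvg_cst m n (A : 'M[C]_(m, n)) : mxcvg F (fun=> A) A.
Proof. by rewrite /mxcvg subrr mxnorm1_0; apply: cvg_cst. Qed.

Lemma mxcvgD m n (u v : T -> 'M[C]_(m, n)) A B :
  mxcvg F u A -> mxcvg F v B -> mxcvg F (fun x => u x + v x) (A + B).
Proof.
move=> uA vB; apply: mxcvg_le (_ : _ + _ @[x --> F] --> _).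
  by apply: nearW => x; rewrite opprD addrACA; apply: mxnorm1D.
by rewrite -[0]addr0; apply: cvgD uA vB.
Qed.

Lemma mxcvg_linear m n p q (f : {linear 'M[C]_(m, n) -> 'M[C]_(p, q)}) u A :
  mxcvg F u A -> mxcvg F (fun x => f (u x)) (f A).
Proof.
have [c _ fc] := linear_mxnorm1_bound f.
move=> uA; apply: mxcvg_le (_ : c * _ @[x --> F] --> _).
  by apply: nearW => x; rewrite -linearB; apply: fc.
by rewrite -[0](mulr0 c); apply: cvgMr.
Qed.

Lemma mxcvgN m n (u : T -> 'M[C]_(m, n)) A :
  mxcvg F u A -> mxcvg F (fun x => - u x) (- A).
Proof. exact: (@mxcvg_linear _ _ _ _ (-%R)). Qed.

Lemma mxcvgB m n (u v : T -> 'M[C]_(m, n)) A B :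
  mxcvg F u A -> mxcvg F v B -> mxcvg F (fun x => u x - v x) (A - B).
Proof. by move=> uA vB; apply: mxcvgD => //; apply: mxcvgN. Qed.

Lemma mxcvg_trC m n (u : T -> 'M[C]_(m, n)) A :
  mxcvg F u A -> mxcvg F (fun x => ((u x)^t*)%sesqui) (A^t*)%sesqui.
Proof.
move=> uA; apply: mxcvg_le uA; apply: nearW => x.
by rewrite -map_mxB -linearB mxnorm1_trC.
Qed.

Lemma mxcvg_mxnorm1 m n (u : T -> 'M[C]_(m, n)) A :
  mxcvg F u A -> mxnorm1 (u x) @[x --> F] --> mxnorm1 A.
Proof.
move=> uA; apply/cvgrPdist_le => e e0.
move/cvgrPdist_le : uA => /(_ e e0); apply: filterS => x.
rewrite sub0r normrN ger0_norm ?mxnorm1_ge0 //; apply: le_trans.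
have := mxnorm1D (u x - A) A; have := mxnorm1D (A - u x) (u x).
by rewrite !subrK (mxnorm1_distC A) ler_norml => *; apply/andP; split; lra.
Qed.

Lemma mxcvgM m n p (u : T -> 'M[C]_(m, n)) (v : T -> 'M[C]_(n, p)) A B :
  mxcvg F u A -> mxcvg F v B -> mxcvg F (fun x => u x *m v x) (A *m B).
Proof.
move=> uA vB; apply: (@mxcvg_le _ _ _ _ (fun x =>
  mxnorm1 (u x - A) * mxnorm1 (v x) + mxnorm1 A * mxnorm1 (v x - B))).
  (* Split u v - A B as (u - A) v + A (v - B). *)
  apply: nearW => x; rewrite -[u x *m _](subrK (A *m v x)) -addrA -mulmxBl -mulmxBr.
  by apply: le_trans (mxnorm1D _ _) _; apply: lerD; apply: mxnorm1M.
rewrite -[0]addr0; apply: cvgD.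
  by rewrite -[0](mul0r (mxnorm1 B)); apply: cvgM => //; apply: mxcvg_mxnorm1.
by rewrite -[0](mulr0 (mxnorm1 A)); apply: cvgMr.
Qed.

End Filter.

Section ProperFilter.
Context {T : topologicalType} {F : set_system T} {FF : ProperFilter F}.

(** The zero function u - u converges to A - B, so the norm of A - B is a limit of zeros. *)
Lemma mxcvg_unique m n (u : T -> 'M[C]_(m, n)) A B :
  mxcvg F u A -> mxcvg F u B -> A = B.
Proof.
move=> uA uB; apply/eqP; rewrite -subr_eq0; apply/eqP/mxnorm1_eq0.
have uAB : mxcvg F (fun x => u x - u x) (A - B) by apply: mxcvgB.
have : mxnorm1 (u x - u x) @[x --> F] --> mxnorm1 (A - B).
  exact: mxcvg_mxnorm1.
under eq_fun do rewrite subrr mxnorm1_0.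
by move/(cvg_lim (@norm_hausdorff R R)) <-; rewrite lim_cst //; apply: norm_hausdorff.
Qed.

Lemma mxcvg_bound m n (u : T -> 'M[C]_(m, n)) A (b : T -> R) c :
  mxcvg F u A -> b x @[x --> F] --> c ->
  (\forall x \near F, mxnorm1 (u x) <= b x) -> mxnorm1 A <= c.
Proof.
move=> uA bc ub; have uA' : mxnorm1 (u x) @[x --> F] --> mxnorm1 A.
  exact: mxcvg_mxnorm1.
exact: ler_cvg_to uA' bc ub.
Qed.

End ProperFilter.

(** This connects norm convergence with the entrywise topology in which the [limn] of [expm] is
    taken. *)
Lemma mxcvg_entry m n (u : nat -> 'M[C]_(m, n)) (A : 'M[C]_(m, n)) :
  mxcvg \oo u A -> u @ \oo --> A.
Proof.
move=> uA; apply/cvg_ballP => e e0.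
(* The radius is a positive element of [Cx R], hence real. *)
have e_real : e = (complex.Re e)%:C by rewrite RRe_real ?gtr0_real.
have e1 : 0 < complex.Re e by rewrite -ltcR -e_real.
move/cvgrPdist_lt : uA => /(_ _ e1); apply: filterS => k.
rewrite sub0r normrN ger0_norm ?mxnorm1_ge0 // => ue; split=> // i j.
rewrite -ball_normE /= e_real -cabsE ltcR; apply: le_lt_trans ue.
rewrite -opprB cabsN; have := cabs_le_mxnorm1 (u k - A) i j.
by rewrite !mxE.
Qed.

Lemma mx_hausdorff m n : hausdorff_space 'M[C]_(m, n).
Proof.
move=> A B AB; apply/matrixP => i j; apply: (@norm_hausdorff C C) => P Q PA QB.
have [M [MP MQ]] : [set M : 'M[C]_(m, n) | P (M i j)] `&`
    [set M : 'M[C]_(m, n) | Q (M i j)] !=set0.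
  apply: AB.
    (* This neighbourhood of A constrains the (i, j) entry only. *)
    exists (fun i' j' => if (i' == i) && (j' == j) then P else setT).
      move=> i' j'; case: ifP => [/andP[/eqP -> /eqP ->]//|_]; exact: filterT.
    by move=> M /(_ i j); rewrite !eqxx.
  exists (fun i' j' => if (i' == i) && (j' == j) then Q else setT).
    move=> i' j'; case: ifP => [/andP[/eqP -> /eqP ->]//|_]; exact: filterT.
  by move=> M /(_ i j); rewrite !eqxx.
by exists (M i j).
Qed.

Lemma mxcvg_lim m n (u : nat -> 'M[C]_(m, n)) (A : 'M[C]_(m, n)) :
  mxcvg \oo u A -> limn u = A.
Proof.
by move=> uA; exact: (cvg_lim (@mx_hausdorff m n) (mxcvg_entry uA)).
Qed.

(** The real and imaginary parts of each entry are dominated by b, so they form absolutely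
    convergent real series; their sums assemble into the limit. *)
Lemma mxcvg_series m n (f : nat -> 'M[C]_(m, n)) (b : nat -> R) :
  (forall k, mxnorm1 (f k) <= b k) -> cvgn (series b) ->
  exists A, mxcvg \oo (series f) A.
Proof.
move=> fb cb.
have b_ge0 k : 0 <= b k by apply: le_trans (fb k); apply: mxnorm1_ge0.
have dom (g : nat -> R) : (forall k, `|g k| <= b k) -> cvgn (series g).
  move=> gb; apply: normed_cvg; apply: series_le_cvg gb cb => //.
pose re i j k := complex.Re (f k i j); pose im i j k := complex.Im (f k i j).
have cre i j : cvgn (series (re i j)).
  apply: dom => k; apply: le_trans (normr_Re_le _) _.
  exact: le_trans (cabs_le_mxnorm1 _ _ _) (fb k).
have cim i j : cvgn (series (im i j)).
  apply: dom => k; apply: le_trans (normr_Im_le _) _.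
  exact: le_trans (cabs_le_mxnorm1 _ _ _) (fb k).
pose A := \matrix_(i, j) ((limn (series (re i j)) +i* limn (series (im i j))) : C).
exists A; apply: (@mxcvg_le _ _ _ _ _ _ _ (fun k => \sum_i \sum_j
  (`|series (re i j) k - limn (series (re i j))| +
   `|series (im i j) k - limn (series (im i j))|))).
  apply: nearW => k; apply: ler_sum => i _; apply: ler_sum => j _.
  apply: le_trans (cabs_le_ReIm _) _; rewrite !mxE ReD ImD ReN ImN /=.
  rewrite summxE.
  suff [-> ->] : complex.Re (\sum_(0 <= k0 < k) f k0 i j) = series (re i j) k /\
    complex.Im (\sum_(0 <= k0 < k) f k0 i j) = series (im i j) k by [].
  rewrite /series /=; elim: k => [|k [IH1 IH2]]; first by rewrite !big_geq.
  by rewrite !big_nat_recr //= ReD ImD IH1 IH2.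
have z (g : nat -> R) : cvgn (series g) ->
    `|series g k - limn (series g)| @[k --> \oo] --> (0 : R).
  move=> cg; rewrite -[0](@normr0 R R); apply: cvg_norm.
  by rewrite -(subrr (limn (series g))); apply: cvgB => //; apply: cvg_cst.
apply: cvg_sum0 => i; apply: cvg_sum0 => j; rewrite -[0]addr0.
by apply: cvgD; apply: z.
Qed.

End MatrixConvergence.

(** * Cauchy products and the matrix exponential *)

Lemma sum_antidiagonal (V : zmodType) (F : nat -> nat -> V) N :
  \sum_(0 <= k < N) \sum_(0 <= i < k.+1) F i (k - i)%N =
  \sum_(0 <= i < N) \sum_(0 <= j < N - i) F i j.
Proof.
elim: N => [|N IH]; first by rewrite !big_geq.
rewrite big_nat_recr //= IH.
(* Row i = N of the old triangle is empty and may be added, so that both triangles have the same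
   rows. *)
have -> : \sum_(0 <= i < N) \sum_(0 <= j < N - i) F i j =
    \sum_(0 <= i < N.+1) \sum_(0 <= j < N - i) F i j.
  by rewrite [RHS]big_nat_recr //= subnn [X in _ + X]big_geq // addr0.
rewrite -big_split; apply: eq_big_nat => i /andP[_ iN] /=.
by rewrite subSn // big_nat_recr.
Qed.

Lemma sum_square_minus_triangle (V : zmodType) (F : nat -> nat -> V) N :
  \sum_(0 <= i < N) \sum_(0 <= j < N) F i j -
  \sum_(0 <= k < N) \sum_(0 <= i < k.+1) F i (k - i)%N =
  \sum_(0 <= i < N) \sum_(N - i <= j < N) F i j.
Proof.
rewrite sum_antidiagonal -sumrB; apply: eq_bigr => i _.
by rewrite (big_cat_nat (n := N - i)) ?leq_subr //= addrC addrK.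
Qed.

Section RealBounds.
Context {R : realType}.

Lemma ler_sum_square_triangle (a b : nat -> R) N :
  (forall k, 0 <= a k) -> (forall k, 0 <= b k) ->
  series a N./2 * series b N./2 <=
  \sum_(0 <= k < N) \sum_(0 <= i < k.+1) a i * b (k - i)%N.
Proof.
move=> a0 b0; rewrite (sum_antidiagonal (fun i j => a i * b j)) /series /=.
have hN2 : (N./2 + N./2 <= N)%N.
  by rewrite addnn -[leqRHS]odd_double_half leq_addl.
have hN : (N./2 <= N)%N by apply: leq_trans hN2; apply: leq_addr.
rewrite [leRHS](big_cat_nat (n := N./2)) //= mulr_suml; apply: ler_wpDr.
  by do 2!apply: sumr_ge0 => ? _; apply: mulr_ge0.
rewrite [leLHS]big_nat [leRHS]big_nat; apply: ler_sum => i /andP[_ iN].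
rewrite mulr_sumr [leRHS](big_cat_nat (n := N./2)) //=.
  by rewrite lerDl; apply: sumr_ge0 => ? _; apply: mulr_ge0.
rewrite leq_subRL ?(leq_trans (ltnW iN)) //; apply: leq_trans hN2.
by rewrite leq_add2r ltnW.
Qed.

Lemma cvg_half (u : nat -> R) (l : R) : u @ \oo --> l -> u k./2 @[k --> \oo] --> l.
Proof.
move=> ul; apply: (cvg_comp half u (G := \oo) _ ul) => A [N _ NA].
exists N.*2 => // k /= Nk.
by apply: NA => /=; rewrite -[N]doubleK half_leq.
Qed.

End RealBounds.

Section MatrixSeries.
Context {R : realType}.
Local Notation C := (Cx R).

(* The terms that the Cauchy product misses are dominated by those of the real
   majorants, whose square of side N./2 lies inside the triangle of side N. *)
Lemma mxcvg_cauchy_product n (a b : nat -> 'M[C]_n) (al be : nat -> R)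
    (A B : 'M[C]_n) :
  (forall k, mxnorm1 (a k) <= al k) -> (forall k, mxnorm1 (b k) <= be k) ->
  cvgn (series al) -> cvgn (series be) ->
  mxcvg \oo (series a) A -> mxcvg \oo (series b) B ->
  mxcvg \oo (series (fun k => \sum_(0 <= i < k.+1) a i *m b (k - i)%N)) (A *m B).
Proof.
move=> aal bbe cal cbe aA bB.
have al0 k : 0 <= al k by apply: le_trans (aal k); apply: mxnorm1_ge0.
have be0 k : 0 <= be k by apply: le_trans (bbe k); apply: mxnorm1_ge0.
pose c := series (fun k => \sum_(0 <= i < k.+1) a i *m b (k - i)%N).
pose d N := series al N * series be N - series al N./2 * series be N./2.
have dist N : mxnorm1 (c N - series a N *m series b N) <= d N.
  have -> : series a N *m series b N =
      \sum_(0 <= i < N) \sum_(0 <= j < N) a i *m b j.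
    by rewrite /series /= mulmx_suml; apply: eq_bigr => i _; rewrite mulmx_sumr.
  rewrite mxnorm1_distC.
  rewrite (sum_square_minus_triangle (fun i j => a i *m b j)).
  apply: le_trans (mxnorm1_sum _ _ _) _.
  apply: (@le_trans _ _ (\sum_(0 <= i < N) \sum_(N - i <= j < N) al i * be j)).
    apply: ler_sum => i _; apply: le_trans (mxnorm1_sum _ _ _) _.
    apply: ler_sum => j _; apply: le_trans (mxnorm1M _ _) _.
    by apply: ler_pM => //; apply: mxnorm1_ge0.
  rewrite -(sum_square_minus_triangle (fun i j => al i * be j)) /d.
  apply: lerB; last exact: ler_sum_square_triangle.
  by rewrite /series /= mulr_suml; apply: ler_sum => i _; rewrite mulr_sumr.
(* Both products have the same limit, as half the index still tends to infinity. *)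
have d0 : d N @[N --> \oo] --> (0 : R).
  rewrite -(subrr (limn (series al) * limn (series be))).
  by apply: cvgB; apply: cvgM => //; apply: cvg_half.
apply: (@mxcvg_le _ _ _ _ _ _ _ _ (fun N =>
  d N + mxnorm1 (series a N *m series b N - A *m B))).
  apply: nearW => N; rewrite -(subrK (series a N *m series b N) (series _ N)).
  rewrite -addrA; apply: le_trans (mxnorm1D _ _) _; rewrite lerD2r.
  exact: dist.
by rewrite -[0]addr0; apply: cvgD => //; apply: mxcvgM.
Qed.

(** * The exponential series: convergence, one-parameter group law, adjoint *)

Definition exp_term n (X : 'M[C]_n) k : 'M[C]_n := k`!%:R^-1 *: X ^+ k.

Lemma cabs_fact_inv k : cabs (k`!%:R^-1 : C) = k`!%:R^-1.
Proof.
rewrite (_ : k`!%:R^-1 = (k`!%:R^-1 : R)%:C).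
  by rewrite cabs_real ger0_norm ?invr_ge0 ?ler0n.
by rewrite fmorphV rmorph_nat.
Qed.

(** The l1 norm of the identity is n, not 1; this factor accounts for the power k = 0. *)
Lemma mxnorm1X n (X : 'M[C]_n) k :
  mxnorm1 (X ^+ k) <= mxnorm1 (1%:M : 'M[C]_n) * mxnorm1 X ^+ k.
Proof.
elim: k => [|k IH]; first by rewrite !expr0 mulr1.
rewrite !exprSr mulrA; apply: le_trans (mxnorm1M _ _) _.
by rewrite ler_wpM2r ?mxnorm1_ge0.
Qed.

Lemma exp_term_bound n (X : 'M[C]_n) k :
  mxnorm1 (exp_term X k) <= mxnorm1 (1%:M : 'M[C]_n) * exp_coeff (mxnorm1 X) k.
Proof.
rewrite /exp_term mxnorm1Z cabs_fact_inv /exp_coeff /= mulrA [leRHS]mulrC.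
by rewrite ler_wpM2l ?invr_ge0 ?ler0n // mxnorm1X.
Qed.

Lemma is_cvg_series_expZ (c x : R) : cvgn (series (fun k => c * exp_coeff x k)).
Proof. by apply: is_cvg_seriesZ; apply: is_cvg_series_exp_coeff. Qed.

Lemma mxcvg_expm n (X : 'M[C]_n) : mxcvg \oo (series (exp_term X)) (expm X).
Proof.
have [E cE] := mxcvg_series (exp_term_bound X) (@is_cvg_series_expZ _ _).
by rewrite /expm (mxcvg_lim cE).
Qed.

(** Multiples of a single X commute, so the Cauchy product of the two series reduces to the binomial
    theorem for the scalars a and b. *)
Lemma expm_scaleD n (X : 'M[C]_n) a b :
  expm ((a + b) *: X) = expm (a *: X) *m expm (b *: X).
Proof.
apply: mxcvg_unique (mxcvg_expm _) _.
have := mxcvg_cauchy_product (exp_term_bound (a *: X)) (exp_term_bound (b *: X))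
  (@is_cvg_series_expZ _ _) (@is_cvg_series_expZ _ _) (mxcvg_expm _) (mxcvg_expm _).
congr (mxcvg _ (series _) _); apply/funext => k; rewrite /exp_term.
have expZ c i : (c *: X) ^+ i = c ^+ i *: X ^+ i.
  elim: i => [|i IH]; first by rewrite !expr0 scale1r.
  by rewrite !exprS IH -mulmxE -scalemxAl -scalemxAr scalerA.
rewrite expZ [a + b]addrC exprDn scaler_suml scaler_sumr big_mkord.
apply: eq_bigr => i _; have ik : (i <= k)%N by rewrite -ltnS.
rewrite !expZ -!scalemxAl -!scalemxAr !scalerA mulmxE -exprD subnKC //.
congr (_ *: _); rewrite -mulr_natl.
have fk : ('C(k, i)%:R * (i`!%:R * (k - i)`!%:R) = k`!%:R :> C).
  by rewrite -!natrM bin_fact.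
have fn m : m`!%:R != 0 :> C by rewrite pnatr_eq0 -lt0n fact_gt0.
have b0 : 'C(k, i)%:R != 0 :> C by rewrite pnatr_eq0 -lt0n bin_gt0.
by rewrite -fk; field; rewrite b0 !fn.
Qed.

Lemma expm_unit n (X : 'M[C]_n) : expm X \in unitmx.
Proof.
have := expm_scaleD X 1 (-1); rewrite subrr scale0r scale1r => e1.
suff e0 : expm (0 : 'M[C]_n) = 1%:M.
  by apply: (mulmx1_unit (B := expm (-1 *: X)) _).1; rewrite -e1 e0.
apply: mxcvg_unique (mxcvg_expm _) _.
apply: (@mxcvg_le _ _ _ _ _ _ _ _ (fun=> 0)) (cvg_cst _).
(* The empty partial sum is 0; from N = 1 on the partial sums equal the identity. *)
exists 1%N => // -[//|N] _ /=; rewrite /series /= big_nat_recl // big1.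
  by rewrite /exp_term expr0 invr1 scale1r addr0 subrr mxnorm1_0.
by move=> i _; rewrite /exp_term expr0n scaler0.
Qed.

Lemma expm_comm n (X : 'M[C]_n) : expm X *m X = X *m expm X.
Proof.
have h1 : mxcvg \oo (fun N => series (exp_term X) N *m X) (expm X *m X).
  by apply: mxcvgM; [apply: mxcvg_expm|apply: mxcvg_cst].
have h2 : mxcvg \oo (fun N => X *m series (exp_term X) N) (X *m expm X).
  by apply: mxcvgM; [apply: mxcvg_cst|apply: mxcvg_expm].
apply: mxcvg_unique h1 _; move: h2; congr (mxcvg _ _ _); apply/funext => N.
rewrite /series /= mulmx_sumr mulmx_suml; apply: eq_bigr => k _.
by rewrite /exp_term -scalemxAl -scalemxAr !mulmxE -exprS -exprSr.
Qed.

Lemma expm_trC n (X : 'M[C]_n) : ((expm X)^t*)%sesqui = expm (X^t*)%sesqui.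
Proof.
have XC k : ((X ^+ k)^t*)%sesqui = ((X^t*)%sesqui) ^+ k :> 'M[C]_n.
  elim: k => [|k IH]; first by rewrite !expr0 trmx1 map_mx1.
  by rewrite exprS exprSr -IH -!mulmxE trmx_mul map_mxM.
suff h : mxcvg \oo (series (exp_term (X^t*)%sesqui)) ((expm X)^t*)%sesqui.
  exact: mxcvg_unique h (mxcvg_expm _).
have h : mxcvg \oo (fun N => (series (exp_term X) N)^t*)%sesqui
    ((expm X)^t*)%sesqui by apply: mxcvg_trC; apply: mxcvg_expm.
move: h; congr (mxcvg _ _ _); apply/funext => N.
rewrite /series /= linear_sum map_mx_sum; apply: eq_bigr => k _.
by rewrite /exp_term linearZ map_mxZ XC /= fmorphV rmorph_nat.
Qed.

End MatrixSeries.

(** * First-order expansion of the exponential *)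

Section DerivativeOfExp.
Context {R : realType}.
Local Notation C := (Cx R).

Lemma mxcvg_shiftS m n (u : nat -> 'M[C]_(m, n)) A :
  mxcvg \oo u A -> mxcvg \oo (fun N => u N.+1) A.
Proof. by rewrite /mxcvg -cvg_shiftS. Qed.

(* [dpow X V k] is the derivative of X ^+ k in the direction V, that is the sum
   of the X ^+ i *m V *m X ^+ (k - 1 - i) for i < k. *)
Fixpoint dpow n (X V : 'M[C]_n) k : 'M[C]_n :=
  if k is k'.+1 then X *m dpow X V k' + V *m X ^+ k' else 0.

(** Induction on k: moving X past an iterated commutator either adds a commutator or leaves X on the
    right, and Pascal's rule collects the two contributions. *)
Lemma dpow_Ad n (X V : 'M[C]_n) k : dpow X V k =
  \sum_(0 <= j < k) 'C(k, j.+1)%:R *: (iter j (Ad X) V *m X ^+ (k - j.+1)).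
Proof.
elim: k => [|k IH]; first by rewrite big_geq.
have XAd j : X *m iter j (Ad X) V = iter j.+1 (Ad X) V + iter j (Ad X) V *m X.
  by rewrite iterS /Ad subrK.
under [RHS]eq_bigr do rewrite subSS binS natrD scalerDl.
(* In the two halves of Pascal's rule, the last term of one vanishes because C(k, k+1) = 0, and the
   j = 0 term of the other is V X^k. *)
rewrite /= IH big_split /= [in RHS]big_nat_recr //= bin_small // scale0r addr0.
rewrite [X in _ = _ + X]big_nat_recl // [RHS]addrCA [RHS]addrC.
congr (_ + _); last by rewrite bin0 scale1r subn0.
rewrite -big_split mulmx_sumr; apply: eq_big_nat => j /andP[_ jk] /=.
rewrite -scalemxAr mulmxA XAd mulmxDl scalerDr addrC -mulmxA.
by rewrite mulmxE -exprS -subSn // subSS.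
Qed.

(** The terms of (e^z - 1)/z at z = Ad_X, applied to V. *)
Definition ad_term n (X V : 'M[C]_n) p : 'M[C]_n :=
  p.+1`!%:R^-1 *: iter p (Ad X) V.

(** Each commutator with X multiplies the norm by at most twice that of X, and 1/(p+1)! is at most
    1/p!. *)
Lemma ad_term_bound n (X V : 'M[C]_n) p :
  mxnorm1 (ad_term X V p) <= mxnorm1 V * exp_coeff (mxnorm1 X + mxnorm1 X) p.
Proof.
rewrite mxnorm1Z cabs_fact_inv /exp_coeff /= mulrA [leRHS]mulrC.
apply: ler_pM; rewrite ?invr_ge0 ?ler0n ?mxnorm1_ge0 //.
  by rewrite lef_pV2 ?posrE ?ltr0n ?fact_gt0 // ler_nat factS leq_pmull.
elim: p => [|p IH]; first by rewrite expr0 mulr1.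
rewrite iterS /Ad; apply: le_trans (mxnorm1B _ _) _.
rewrite exprS mulrCA mulrDl; apply: lerD; apply: le_trans (mxnorm1M _ _) _.
  by rewrite ler_wpM2l ?mxnorm1_ge0.
by rewrite mulrC ler_wpM2l ?mxnorm1_ge0.
Qed.

Lemma mxcvg_ad n (X V : 'M[C]_n) : exists Phi, mxcvg \oo (series (ad_term X V)) Phi.
Proof. exact: mxcvg_series (ad_term_bound X V) (@is_cvg_series_expZ _ _ _). Qed.

(** The Cauchy product of the [ad_term] and exponential series, as C(k+1, j+1)/(k+1)! = 1/((j+1)!
    (k-j)!). The index is shifted because the term of order 0 vanishes. *)
Lemma mxcvg_dpow n (X V Phi : 'M[C]_n) : mxcvg \oo (series (ad_term X V)) Phi ->
  mxcvg \oo (series (fun k => k.+1`!%:R^-1 *: dpow X V k.+1)) (Phi *m expm X).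
Proof.
move=> adPhi; have := mxcvg_cauchy_product (ad_term_bound X V) (exp_term_bound X)
  (@is_cvg_series_expZ _ _ _) (@is_cvg_series_expZ _ _ _) adPhi (mxcvg_expm X).
congr (mxcvg _ (series _) _); apply/funext => k.
rewrite dpow_Ad scaler_sumr; apply: eq_big_nat => j /andP[_ jk].
rewrite /ad_term /exp_term -scalemxAl -scalemxAr !scalerA subSS; congr (_ *: _).
have fk : ('C(k.+1, j.+1)%:R * (j.+1`!%:R * (k - j)`!%:R) = k.+1`!%:R :> C).
  by rewrite -!natrM -[(k - j)%N]subSS bin_fact.
have fn m : m`!%:R != 0 :> C by rewrite pnatr_eq0 -lt0n fact_gt0.
have b0 : 'C(k.+1, j.+1)%:R != 0 :> C by rewrite pnatr_eq0 -lt0n bin_gt0.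
by rewrite -fk; field; rewrite b0 !fn.
Qed.

Lemma dpowB n (X V W : 'M[C]_n) k : dpow X (V - W) k = dpow X V k - dpow X W k.
Proof.
elim: k => [|k IH] /=; first by rewrite subr0.
by rewrite IH mulmxBr mulmxBl opprD addrACA.
Qed.

(** * Geometric bounds for powers and their first-order remainders *)

Section PowerBounds.
Variables (n : nat) (X V : 'M[C]_n).
Let c := mxnorm1 (1%:M : 'M[C]_n).
Let x := mxnorm1 X.
Let v := mxnorm1 V.
(** This dominates the norms of both X and X + V, with room left for the recursion below. *)
Let y := x + v + 1.

Let c0 : 0 <= c. Proof. exact: mxnorm1_ge0. Qed.
Let x0 : 0 <= x. Proof. exact: mxnorm1_ge0. Qed.
Let v0 : 0 <= v. Proof. exact: mxnorm1_ge0. Qed.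
Let xy : x + 1 <= y. Proof. by rewrite lerD2r lerDl. Qed.
Let y0 : 0 <= y. Proof. by rewrite !addr_ge0. Qed.

(* All three bounds are propagated by a recursion of the form
   t (k+1) <= x * t k + s * y ^+ k, which x + 1 <= y turns into t k <= s * y ^+ k. *)
Let step (t s : R) k : 0 <= s -> t <= s * y ^+ k ->
  x * t + s * y ^+ k <= s * y ^+ k.+1.
Proof.
move=> s0 tk; have sy : 0 <= s * y ^+ k by rewrite mulr_ge0 ?exprn_ge0.
apply: (@le_trans _ _ ((x + 1) * (s * y ^+ k))).
  by rewrite mulrDl mul1r lerD2r ler_wpM2l.
by rewrite exprS [leRHS]mulrCA ler_wpM2r.
Qed.

(** The direction W is independent of the V inside [y]; the Taylor estimate uses V - W. *)
Lemma dpow_bound W k : mxnorm1 (dpow X W k) <= c * mxnorm1 W * y ^+ k.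
Proof.
have s0 : 0 <= c * mxnorm1 W by rewrite mulr_ge0 ?mxnorm1_ge0.
elim: k => [|k IH]; first by rewrite mxnorm1_0 mulr1.
apply: le_trans (step s0 IH); apply: le_trans (mxnorm1D _ _) _.
apply: lerD; apply: le_trans (mxnorm1M _ _) _ => //.
rewrite [c * _]mulrC -mulrA ler_wpM2l ?mxnorm1_ge0 //.
apply: le_trans (mxnorm1X _ _) _; rewrite ler_wpM2l // lerXn2r ?nnegrE //.
by apply: le_trans xy; rewrite lerDl.
Qed.

Lemma powD_sub_bound k : mxnorm1 ((X + V) ^+ k - X ^+ k) <= c * v * y ^+ k.
Proof.
have s0 : 0 <= c * v by rewrite mulr_ge0.
elim: k => [|k IH]; first by rewrite !expr0 subrr mxnorm1_0 mulr1.
apply: le_trans (step s0 IH).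
rewrite !exprS mulrDl addrAC -mulrBr; apply: le_trans (mxnorm1D _ _) _.
apply: lerD; apply: le_trans (mxnorm1M _ _) _; first by rewrite ler_wpM2l.
rewrite [c * _]mulrC -mulrA ler_wpM2l //.
apply: le_trans (mxnorm1X _ _) _; rewrite ler_wpM2l // lerXn2r ?nnegrE //.
  exact: mxnorm1_ge0.
by apply: le_trans (mxnorm1D _ _) _; rewrite lerDl.
Qed.

(** The remainder satisfies r(k+1) = X r(k) + V ((X + V)^k - X^k); the last factor is already first
    order in V, which gives the square. *)
Lemma powD_sub_dpow_bound k :
  mxnorm1 ((X + V) ^+ k - X ^+ k - dpow X V k) <= c * v ^+ 2 * y ^+ k.
Proof.
have s0 : 0 <= c * v ^+ 2 by rewrite mulr_ge0 ?exprn_ge0.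
elim: k => [|k IH]; first by rewrite !expr0 !subrr mxnorm1_0 mulr1.
apply: le_trans (step s0 IH).
have -> : (X + V) ^+ k.+1 - X ^+ k.+1 - dpow X V k.+1 =
    X *m ((X + V) ^+ k - X ^+ k - dpow X V k) + V *m ((X + V) ^+ k - X ^+ k).
  by rewrite /= !exprS !mulmxE !mulrBr mulrDl opprD (addrAC (X * _)) addrACA.
apply: le_trans (mxnorm1D _ _) _.
apply: lerD; apply: le_trans (mxnorm1M _ _) _; first by rewrite ler_wpM2l.
have -> : c * v ^+ 2 * y ^+ k = v * (c * v * y ^+ k) by ring.
by rewrite ler_wpM2l // powD_sub_bound.
Qed.

End PowerBounds.

(** Along a curve the increment V is only approximately the linear increment W. Termwise, the
    remainder for W is the quadratic remainder for V plus [dpow] in the direction V - W; the bounds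
    sum to a real exponential. *)
Lemma expm_taylor1 n (X V W Phi : 'M[C]_n) :
  mxcvg \oo (series (ad_term X W)) Phi ->
  mxnorm1 (expm (X + V) - expm X - Phi *m expm X) <=
  mxnorm1 (1%:M : 'M[C]_n) * (mxnorm1 V ^+ 2 + mxnorm1 (V - W)) *
  expR (mxnorm1 X + mxnorm1 V + 1).
Proof.
set s := mxnorm1 1%:M * _; set y := _ + 1 => adPhi; have s0 : 0 <= s.
  by rewrite mulr_ge0 ?addr_ge0 ?exprn_ge0 ?mxnorm1_ge0.
pose g k := k`!%:R^-1 *: ((X + V) ^+ k - X ^+ k - dpow X W k).
have gcvg : mxcvg \oo (fun N => series g N.+1)
    (expm (X + V) - expm X - Phi *m expm X).
  have h : mxcvg \oo (fun N => series (exp_term (X + V)) N.+1 -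
      series (exp_term X) N.+1 -
      series (fun k => k.+1`!%:R^-1 *: dpow X W k.+1) N)
      (expm (X + V) - expm X - Phi *m expm X).
    apply: mxcvgB; last exact: mxcvg_dpow.
    by apply: mxcvgB; apply: mxcvg_shiftS; apply: mxcvg_expm.
  move: h; congr (mxcvg _ _ _); apply/funext => N.
  (* The shift costs nothing, since [dpow X W 0] is 0. *)
  have -> : series (fun k => k.+1`!%:R^-1 *: dpow X W k.+1) N =
      series (fun k => k`!%:R^-1 *: dpow X W k) N.+1.
    by rewrite /series /= [RHS]big_nat_recl //= scaler0 add0r.
  rewrite /series /= -!sumrB; apply: eq_bigr => k _.
  by rewrite /g !scalerBr.
have gb : s * series (exp_coeff y) N.+1 @[N --> \oo] --> s * expR y.
  apply: cvgMr; rewrite (cvg_shiftS (series (exp_coeff y))).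
  exact: is_cvg_series_exp_coeff.
apply: mxcvg_bound gcvg gb _; apply: nearW => N.
rewrite /series /= mulr_sumr; apply: le_trans (mxnorm1_sum _ _ _) _.
apply: ler_sum => k _; rewrite /g mxnorm1Z cabs_fact_inv /exp_coeff /=.
rewrite mulrA [leRHS]mulrC ler_wpM2l ?invr_ge0 ?ler0n //.
have -> : (X + V) ^+ k - X ^+ k - dpow X W k =
    (X + V) ^+ k - X ^+ k - dpow X V k + dpow X (V - W) k.
  by rewrite dpowB addrA subrK.
apply: le_trans (mxnorm1D _ _) _; rewrite /s mulrDr mulrDl.
by apply: lerD; [apply: powD_sub_dpow_bound|apply: dpow_bound].
Qed.

End DerivativeOfExp.

(** * Differentiation of matrix-valued functions of a real variable *)

Section MatrixDerivative.
Context {R : realType}.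
Local Notation C := (Cx R).

(** A real derivative taken in norm, so that products, inverses and exponentials are handled as
    whole matrices. [mxderivable_mxder] leads here from entrywise derivatives, and [mxder_tr_Re]
    leads back to real functions. *)
Definition mxder m n (F : R -> 'M[C]_(m, n)) (t : R) (D : 'M[C]_(m, n)) :=
  mxcvg (0 : R)^' (fun h : R => (h^-1)%:C *: (F (h + t) - F t)) D.

Lemma cvg_is_derive (f : R -> R) (t d : R) :
  h^-1 * (f (h + t) - f t) @[h --> (0 : R)^'] --> d -> is_derive t 1 f d.
Proof.
move=> fd; have fd' : h^-1 *: ((f \o shift t) (h *: 1) - f t) @[h --> (0 : R)^'] --> d.
  by under eq_fun do rewrite /= [_%:A]mulr1.
by apply: DeriveDef; [apply: cvgP fd'|apply: cvg_lim fd'; apply: norm_hausdorff].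
Qed.

Lemma derivable_cvg (f : R -> R) (t : R) : derivable f t 1 ->
  h^-1 * (f (h + t) - f t) @[h --> (0 : R)^'] --> 'D_1 f t.
Proof.
rewrite /derivable /derive => fd; suff -> : (fun h => h^-1 * (f (h + t) - f t)) =
    (fun h => h^-1 *: ((f \o shift t) (h *: 1) - f t)) by exact: fd.
by apply/funext => h; rewrite /= [_%:A]mulr1.
Qed.

Lemma cvg_dist0 (T : Type) (F : set_system T) {FF : Filter F} (f : T -> R) (l : R) :
  f x @[x --> F] --> l -> `|f x - l| @[x --> F] --> (0 : R).
Proof.
move=> fl; rewrite -[X in _ --> X](@normr0 R R) -(subrr l); apply: cvg_norm.
by apply: cvgB => //; apply: cvg_cst.
Qed.

Lemma mxderivable_mxder m n (F : R -> 'M[C]_(m, n)) t :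
  mxderivable F t -> mxder F t (mxderive F t).
Proof.
move=> dF.
pose e i j h := `|h^-1 * (complex.Re (F (h + t) i j) - complex.Re (F t i j)) -
    'D_1 (fun s => complex.Re (F s i j)) t| +
  `|h^-1 * (complex.Im (F (h + t) i j) - complex.Im (F t i j)) -
    'D_1 (fun s => complex.Im (F s i j)) t|.
apply: (@mxcvg_le _ _ _ _ _ _ _ _ (fun h => \sum_i \sum_j e i j h)).
  apply: nearW => h; apply: ler_sum => i _; apply: ler_sum => j _.
  apply: le_trans (cabs_le_ReIm _) _.
  by rewrite !mxE !(ReD, ImD, ReN, ImN, Re_realM, Im_realM) /=.
apply: cvg_sum0 => i; apply: cvg_sum0 => j; rewrite -[X in _ --> X]addr0.
have [dre dim] := dF i j.
by apply: cvgD; [exact: cvg_dist0 (derivable_cvg dre)|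
                exact: cvg_dist0 (derivable_cvg dim)].
Qed.

Lemma cvg_dnbhs0_norm : `|h| @[h --> (0 : R)^'] --> (0 : R).
Proof.
rewrite -[X in _ --> X](@normr0 R R); apply: cvg_norm.
apply: cvg_trans (@nbhs_dnbhs _ (0 : R)).
exact: cvg_id.
Qed.

(** The increment is h times a difference quotient whose norm converges. *)
Lemma mxder_cvg m n (F : R -> 'M[C]_(m, n)) t D :
  mxder F t D -> mxcvg (0 : R)^' (fun h => F (h + t)) (F t).
Proof.
move=> dF; apply: (@mxcvg_le _ _ _ _ _ _ _ _ (fun h : R =>
  `|h| * mxnorm1 ((h^-1)%:C *: (F (h + t) - F t)))).
  near=> h; have h0 : h != 0 by near: h; apply: nbhs_dnbhs_neq.
  rewrite mxnorm1Z mulrA cabs_real -normrM mulfV // normr1 mul1r.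
  exact: lexx.
rewrite -[X in _ --> X](mul0r (mxnorm1 D)); apply: cvgM; first exact: cvg_dnbhs0_norm.
exact: mxcvg_mxnorm1.
Unshelve. all: by end_near. Qed.

Lemma mxder_linear m n p q (f : {linear 'M[C]_(m, n) -> 'M[C]_(p, q)}) F t D :
  mxder F t D -> mxder (fun s => f (F s)) t (f D).
Proof.
move=> dF; rewrite /mxder; under eq_fun do rewrite -linearB -linearZ.
exact: mxcvg_linear.
Qed.

Lemma mxderN m n (F : R -> 'M[C]_(m, n)) t D :
  mxder F t D -> mxder (fun s => - F s) t (- D).
Proof. exact: (@mxder_linear _ _ _ _ (-%R)). Qed.

Lemma mxderM m n p (F : R -> 'M[C]_(m, n)) (G : R -> 'M[C]_(n, p)) t D E :
  mxder F t D -> mxder G t E ->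
  mxder (fun s => F s *m G s) t (D *m G t + F t *m E).
Proof.
move=> dF dG.
have h : mxcvg (0 : R)^' (fun h => (h^-1)%:C *: (F (h + t) - F t) *m G (h + t) +
    F t *m ((h^-1)%:C *: (G (h + t) - G t))) (D *m G t + F t *m E).
  apply: mxcvgD; apply: mxcvgM => //; last exact: mxcvg_cst.
  exact: mxder_cvg dG.
move: h; congr (mxcvg _ _ _); apply/funext => h.
by rewrite -scalemxAl -scalemxAr -scalerDr mulmxBl mulmxBr addrA subrK.
Qed.

(** With K(h) the inverse at h + t, K(h) - K = - K(h) (G(h+t) - G(t)) K. Once the increment has norm
    at most 1/(2k), half of the norm of K(h) is absorbed, leaving the bound 2k. *)
Lemma mxcvg_invmx n (G : R -> 'M[C]_n) t : (forall s, G s \in unitmx) ->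
  mxcvg (0 : R)^' (fun h => G (h + t)) (G t) ->
  mxcvg (0 : R)^' (fun h => invmx (G (h + t))) (invmx (G t)).
Proof.
move=> Gu cG; set K := invmx (G t); set k := mxnorm1 K.
have k0 : 0 <= k by apply: mxnorm1_ge0.
pose d h := mxnorm1 (G (h + t) - G t).
have dK h : invmx (G (h + t)) - K = - (invmx (G (h + t)) *m (G (h + t) - G t) *m K).
  rewrite mulmxBr mulmxBl mulVmx // mul1mx -[_ *m G t *m K]mulmxA mulmxV //.
  by rewrite mulmx1 opprB.
have b h : mxnorm1 (invmx (G (h + t)) - K) <=
    mxnorm1 (invmx (G (h + t))) * d h * k.
  rewrite dK mxnorm1N; apply: le_trans (mxnorm1M _ _) _.
  by rewrite ler_wpM2r // mxnorm1M.
apply: (@mxcvg_le _ _ _ _ _ _ _ _ (fun h => 2 * k * k * d h)); last first.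
  by rewrite -[X in _ --> X](mulr0 (2 * k * k)); apply: cvgMr.
have small : \forall h \near (0 : R)^', d h * k <= 2^-1.
  have dk : d h * k @[h --> (0 : R)^'] --> 0 * k by apply: cvgMl.
  by apply: (cvgr_le _ dk); rewrite mul0r; lra.
apply: filterS small => h dh; apply: le_trans (b h) _.
have a0 := mxnorm1_ge0 (invmx (G (h + t))).
have d0 : 0 <= d h by apply: mxnorm1_ge0.
have a2 : mxnorm1 (invmx (G (h + t))) <= 2 * k.
  have := mxnorm1D (invmx (G (h + t)) - K) K; rewrite subrK.
  have := b h; rewrite -mulrA.
  have := ler_wpM2l a0 dh; rewrite -/k; lra.
have -> : 2 * k * k * d h = 2 * k * (d h * k) by ring.
by rewrite -mulrA ler_wpM2r // mulr_ge0.
Qed.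

(** Divide the same identity by h and use continuity of the inverse. *)
Lemma mxder_invmx n (G : R -> 'M[C]_n) t D : (forall s, G s \in unitmx) ->
  mxder G t D ->
  mxder (fun s => invmx (G s)) t (- (invmx (G t) *m D *m invmx (G t))).
Proof.
move=> Gu dG; set K := invmx (G t).
have h : mxcvg (0 : R)^' (fun h => - (invmx (G (h + t)) *m
    ((h^-1)%:C *: (G (h + t) - G t)) *m K)) (- (K *m D *m K)).
  apply: mxcvgN; apply: mxcvgM; last exact: mxcvg_cst.
  by apply: mxcvgM => //; apply: mxcvg_invmx => //; apply: mxder_cvg dG.
move: h; congr (mxcvg _ _ _); apply/funext => h.
rewrite -scalemxAr -scalemxAl -scalerN; congr (_ *: _).
rewrite mulmxBr mulmxBl mulVmx // mul1mx -[_ *m G t *m K]mulmxA mulmxV //.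
by rewrite mulmx1 opprB.
Qed.

Lemma mxder_expm n (X : R -> 'M[C]_n) t D Phi : mxder X t D ->
  mxcvg \oo (series (ad_term (X t) D)) Phi ->
  mxder (fun s => expm (X s)) t (Phi *m expm (X t)).
Proof.
move=> dX cPhi; have cX := mxder_cvg dX.
pose V h := X (h + t) - X t; pose q h := (h^-1)%:C *: V h.
pose x := mxnorm1 (X t); pose c := mxnorm1 (1%:M : 'M[C]_n).
have V0 : mxnorm1 (V h) @[h --> (0 : R)^'] --> (0 : R) by [].
(* The Taylor bound with increment V(h) and linear part h D, divided by |h|: one factor V(h) becomes
   the quotient q(h), and V(h) - h D becomes q(h) - D. *)
apply: (@mxcvg_le _ _ _ _ _ _ _ _ (fun h =>
    c * (mxnorm1 (q h) * mxnorm1 (V h) + mxnorm1 (q h - D)) *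
    expR (x + mxnorm1 (V h) + 1))); last first.
  rewrite -[X in _ --> X](mul0r (expR (x + 0 + 1))); apply: cvgM; last first.
    apply: (continuous_cvg _ (@continuous_expR R _)).
    by apply: cvgD; [apply: cvgD => //|]; apply: cvg_cst.
  rewrite -[X in _ --> X](mulr0 c); apply: cvgMr; rewrite -[X in _ --> X]addr0.
  apply: cvgD => //.
  rewrite -[X in _ --> X](mulr0 (mxnorm1 D)); apply: cvgM => //; exact: mxcvg_mxnorm1.
near=> h; have h0 : h != 0 by near: h; apply: nbhs_dnbhs_neq.
have hC : (h^-1)%:C * h%:C = 1 :> C by rewrite -rmorphM mulVf.
(* Iterated commutators are linear in the direction, so the limit scales by h. *)
have cPhih : mxcvg \oo (series (ad_term (X t) (h%:C *: D))) (h%:C *: Phi).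
  have : mxcvg \oo (fun N => h%:C *: series (ad_term (X t) D) N) (h%:C *: Phi).
    exact: (mxcvg_linear (GRing.scale (h%:C : C))).
  congr (mxcvg _ _ _); apply/funext => N; rewrite /series /= scaler_sumr.
  apply: eq_bigr => p _; rewrite /ad_term scalerA mulrC -scalerA; congr (_ *: _).
  elim: p => [//|p IH]; rewrite !iterS -IH /Ad.
  by rewrite -scalemxAl -scalemxAr scalerBr.
have XV : X t + V h = X (h + t) by rewrite /V addrC subrK.
have := expm_taylor1 (V h) cPhih; rewrite XV => le1.
have -> : (h^-1)%:C *: (expm (X (h + t)) - expm (X t)) - Phi *m expm (X t) =
    (h^-1)%:C *: (expm (X (h + t)) - expm (X t) - (h%:C *: Phi) *m expm (X t)).
  by rewrite -scalemxAl [RHS]scalerBr scalerA hC scale1r.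
rewrite mxnorm1Z; apply: le_trans (ler_wpM2l (cabs_ge0 _) le1) _.
rewrite mulrA ler_wpM2r ?expR_ge0 // mulrCA ler_wpM2l ?mxnorm1_ge0 //.
rewrite mulrDr lerD //; first by rewrite [mxnorm1 (q h)]mxnorm1Z expr2 mulrA.
by rewrite -mxnorm1Z scalerBr scalerA hC scale1r.
Unshelve. all: by end_near. Qed.

Lemma mxder_tr_Re n (F : R -> 'M[C]_n) t D : mxder F t D ->
  is_derive t 1 (fun s => complex.Re (\tr (F s))) (complex.Re (\tr D)).
Proof.
move=> dF; apply: cvg_is_derive; apply/cvgrPdist_le => e e0.
move/cvgrPdist_le : dF => /(_ e e0); apply: filterS => h.
rewrite sub0r normrN ger0_norm ?mxnorm1_ge0 //; apply: le_trans.
apply: le_trans (cabs_mxtrace_le _); apply: le_trans (normr_Re_le _).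
by rewrite distrC [\tr (_ - D)]raddfB /= mxtraceZ [\tr (_ - F t)]raddfB /=
  !(ReD, ReN, Re_realM).
Qed.

Lemma mxder_tr_Im n (F : R -> 'M[C]_n) t D : mxder F t D ->
  is_derive t 1 (fun s => complex.Im (\tr (F s))) (complex.Im (\tr D)).
Proof.
move=> dF; apply: cvg_is_derive; apply/cvgrPdist_le => e e0.
move/cvgrPdist_le : dF => /(_ e e0); apply: filterS => h.
rewrite sub0r normrN ger0_norm ?mxnorm1_ge0 //; apply: le_trans.
apply: le_trans (cabs_mxtrace_le _); apply: le_trans (normr_Im_le _).
by rewrite distrC [\tr (_ - D)]raddfB /= mxtraceZ [\tr (_ - F t)]raddfB /=
  !(ImD, ImN, Im_realM).
Qed.

(** The imaginary part of the trace is constantly 0, hence so is its derivative. *)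
Lemma mxder_tr_real n (F : R -> 'M[C]_n) t D : (forall s, \tr (F s) \is Num.real) ->
  mxder F t D -> (complex.Re (\tr D))%:C = \tr D.
Proof.
move=> Fr dF; suff D0 : complex.Im (\tr D) = 0.
  by move: D0; case: (\tr D) => a b /= ->.
have := @derive_val _ _ _ _ _ _ _ (mxder_tr_Im dF).
have -> : (fun s => complex.Im (\tr (F s))) = cst 0.
  by apply/funext => s; have /complex_realP[k ->] := Fr s.
by rewrite derive_cst.
Qed.

End MatrixDerivative.

(** * Positive definite matrices and the partial trace *)

Section PositiveMatrices.
Context {C : numClosedFieldType}.
Local Open Scope sesquilinear_scope.
Local Open Scope ring_scope.

Definition posdef n (A : 'M[C]_n) :=
  forall u : 'cV[C]_n, u != 0 -> 0 < (u^t* *m A *m u) 0 0.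

Lemma trCK m n (A : 'M[C]_(m, n)) : A^t*^t* = A.
Proof. by apply/matrixP => i j; rewrite !mxE conjCK. Qed.

Lemma trCM m n p (A : 'M[C]_(m, n)) (B : 'M[C]_(n, p)) :
  (A *m B)^t* = B^t* *m A^t*.
Proof. by rewrite trmx_mul map_mxM. Qed.

Lemma trC0 m n : (0 : 'M[C]_(m, n))^t* = 0.
Proof. by rewrite trmx0 map_mx0. Qed.

Lemma trCB m n (A B : 'M[C]_(m, n)) : (A - B)^t* = A^t* - B^t*.
Proof. by apply/matrixP => i j; rewrite !mxE rmorphB. Qed.

Lemma trCZ m n a (A : 'M[C]_(m, n)) : (a *: A)^t* = a^* *: A^t*.
Proof. by apply/matrixP => i j; rewrite !mxE rmorphM. Qed.

Lemma qformE n (A : 'M[C]_n) (u v : 'cV[C]_n) :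
  (u^t* *m A *m v) 0 0 = \sum_x \sum_y (u x 0)^* * A x y * v y 0.
Proof.
rewrite mxE exchange_big; apply: eq_bigr => y _; rewrite mxE mulr_suml.
by apply: eq_bigr => x _; rewrite !mxE.
Qed.

Lemma qform_conj n (A : 'M[C]_n) (u v : 'cV[C]_n) :
  ((u^t* *m A *m v) 0 0)^* = (v^t* *m A^t* *m u) 0 0.
Proof.
have <- : (u^t* *m A *m v)^t* = v^t* *m A^t* *m u by rewrite !trCM trCK mulmxA.
by rewrite [RHS]mxE [in RHS]mxE.
Qed.

Lemma sqnorm_gt0 n (u : 'cV[C]_n) : u != 0 -> 0 < (u^t* *m u) 0 0.
Proof.
move=> u0; have sq i : (u^t* 0 i) * u i 0 = `|u i 0| ^+ 2.
  by rewrite !mxE normCKC.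
rewrite mxE lt_def sumr_ge0 ?andbT => [|i _]; last by rewrite sq exprn_ge0.
apply: contra u0 => /eqP s0; apply/eqP/matrixP => i j; rewrite ord1 mxE.
have /psumr_eq0P s0' : forall i, true -> 0 <= (u^t* 0 i) * u i 0.
  by move=> k _; rewrite sq exprn_ge0.
by have := s0' s0 i isT; rewrite sq => /eqP; rewrite expf_eq0 /= normr_eq0 => /eqP.
Qed.

(** The form would vanish at the adjoint of a nonzero row vector in the left kernel. *)
Lemma posdef_unit n (A : 'M[C]_n) : posdef A -> A \in unitmx.
Proof.
move=> pA; rewrite unitmxE unitfE; apply/negP => /det0P [v v0 vA].
have := pA (v^t*); rewrite trCK vA mul0mx mxE ltxx => h.
suff : false by []; apply: h; apply: contra v0 => /eqP v0.
by rewrite -[v]trCK v0 trC0.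
Qed.

Lemma unit_posdef_gram n (B : 'M[C]_n) : B \in unitmx -> posdef (B^t* *m B).
Proof.
move=> Bu u u0; rewrite mulmxA -trCM -mulmxA; apply: sqnorm_gt0.
by apply: contra u0 => /eqP Bu0; rewrite -[u](mulKmx Bu) Bu0 mulmx0.
Qed.

(** With u = A w, the form of the inverse at u is the conjugate of the positive form of A at w. *)
Lemma posdef_invmx n (A : 'M[C]_n) : posdef A -> posdef (invmx A).
Proof.
move=> pA u u0; have Au := posdef_unit pA; set w := invmx A *m u.
have uE : u = A *m w by rewrite mulKVmx.
have w0 : w != 0 by apply: contra u0 => /eqP w0; rewrite uE w0 mulmx0.
have -> : (u^t* *m invmx A *m u) 0 0 = ((w^t* *m A *m w) 0 0)^*.
  by rewrite qform_conj -mulmxA -/w {1}uE trCM.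
by rewrite conj_Creal ?gtr0_real ?pA.
Qed.

(** The trace is the sum of the form of A over the columns of B, one of which is nonzero. *)
Lemma posdef_trace n p (A : 'M[C]_n) (B : 'M[C]_(n, p)) :
  posdef A -> B != 0 -> 0 < \tr (B^t* *m A *m B).
Proof.
move=> pA B0.
have trE : \tr (B^t* *m A *m B) = \sum_j ((col j B)^t* *m A *m col j B) 0 0.
  apply: eq_bigr => j _; rewrite qformE mxE exchange_big.
  apply: eq_bigr => y _; rewrite mxE mulr_suml.
  by apply: eq_bigr => x _; rewrite !mxE.
have q0 (u : 'cV[C]_n) : 0 <= (u^t* *m A *m u) 0 0.
  have [->|u0] := eqVneq u 0; first by rewrite mulmx0 mxE.
  exact: ltW (pA u u0).
have [j Bj] : exists j, col j B != 0.
  apply/existsP; apply: contraR B0; rewrite negb_exists => /forallP B0.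
  apply/eqP/matrixP => i j; have := B0 j; rewrite negbK => /eqP/matrixP/(_ i 0).
  by rewrite !mxE.
by rewrite trE (bigD1 j) //= ltr_pwDl ?pA // sumr_ge0.
Qed.

Lemma posdef_trace_gt0 n (A : 'M[C]_n) : (0 < n)%N -> posdef A -> 0 < \tr A.
Proof.
case: n A => // n A _ pA; have := posdef_trace pA (oner_neq0 _ : 1%:M != 0).
by rewrite trmx1 map_mx1 mul1mx mulmx1.
Qed.

(** Polarization: reality of the form at u + v and at u + i v determines both the sum and the
    difference of the conjugated cross terms. *)
Lemma psdmx_trC n (A : 'M[C]_n) : psdmx A -> A^t* = A.
Proof.
move=> pA; pose q (u v : 'cV[C]_n) : C := (u^t* *m A *m v) 0 0.
have qDl u v w : q (u + v) w = q u w + q v w.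
  by rewrite /q linearD map_mxD !mulmxDl mxE.
have qDr u v w : q w (u + v) = q w u + q w v by rewrite /q mulmxDr mxE.
have qr u : (q u u)^* = q u u by apply: conj_Creal; apply: ger0_real; apply: pA.
have cross u v : (q u v)^* + (q v u)^* = q u v + q v u.
  have := qr (u + v); rewrite qDl !qDr !rmorphD /= !qr => h.
  transitivity (q u u + (q u v)^* + ((q v u)^* + q v v) - q u u - q v v); first by ring.
  by rewrite h; ring.
have herm u v : (q u v)^* = q v u.
  have h1 := cross u v; have := cross u ('i%R *: v).
  have -> : q u ('i%R *: v) = 'i%R * q u v by rewrite /q -scalemxAr mxE.
  have -> : q ('i%R *: v) u = - 'i%R * q v u.
    by rewrite /q trCZ conjCi -!scalemxAl mxE.
  rewrite !rmorphM rmorphN /= conjCi opprK => h2.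
  have i0 : 'i%R != 0 :> C by apply: neq0Ci.
  have h3 : - (q u v)^* + (q v u)^* = q u v - q v u.
    by apply: (mulfI i0); move: h2; rewrite !mulNr mulrDr mulrBr mulrN.
  have two : 2 != 0 :> C by rewrite pnatr_eq0.
  apply: (mulfI two).
  have -> : 2 * (q u v)^* = ((q u v)^* + (q v u)^*) - (- (q u v)^* + (q v u)^*) by ring.
  by rewrite h1 h3; ring.
apply/matrixP => i j.
have qE k l : q (delta_mx k 0) (delta_mx l 0) = A k l.
  rewrite /q trmx_delta map_delta_mx -mulmxA -colE -rowE !mxE //.
by rewrite !mxE -!qE herm.
Qed.

(** If the form vanished at u, a small step from u along - A u would make it negative, since A u is
    nonzero. *)
Lemma psdmx_unit_posdef n (A : 'M[C]_n) : psdmx A -> A \in unitmx -> posdef A.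
Proof.
move=> pA Au u u0; rewrite lt_def pA andbT; apply/eqP => qu0.
have AC := psdmx_trC pA; pose v := A *m u.
have v0 : v != 0 by apply: contra u0 => /eqP v0; rewrite -[u](mulKmx Au) -/v v0 mulmx0.
have N0 := sqnorm_gt0 v0; set N := (v^t* *m v) 0 0 in N0.
have Q0 := pA v; set Q := (v^t* *m A *m v) 0 0 in Q0.
have Q1 : 0 < Q + 1 by rewrite ltr_wpDl.
(* The form at u - t v is t^2 Q - 2 t N. The denominator Q + 1 stays positive even if Q = 0, and
   this t gives the negative value - N^2 (Q + 2)/(Q + 1)^2. *)
pose t := N / (Q + 1); have t0 : 0 < t by rewrite divr_gt0.
have tr : t^* = t by rewrite conj_Creal // gtr0_real.
have vAu : v^t* *m A *m u = v^t* *m v by rewrite -mulmxA.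
have uAv : u^t* *m A *m v = v^t* *m v by rewrite -{1}AC -trCM.
have := pA (u - t *: v).
have -> : (((u - t *: v)^t* *m A *m (u - t *: v)) 0 0 = t * t * Q - 2 * t * N).
  rewrite trCB trCZ tr !mulmxBl !mulmxBr.
  rewrite -!scalemxAr -!scalemxAl vAu uAv.
  have subE (X Y : 'M[C]_1) : (X - Y) 0 0 = X 0 0 - Y 0 0 by rewrite !mxE.
  have scaleE a (X : 'M[C]_1) : (a *: X) 0 0 = a * X 0 0 by rewrite !mxE.
  by rewrite !(subE, scaleE) qu0 -/N -/Q; ring.
have -> : t * t * Q - 2 * t * N = - (N ^+ 2 * (Q + 2) / (Q + 1) ^+ 2).
  by rewrite /t; field; rewrite gt_eqF.
rewrite oppr_ge0 => /le_gtF; rewrite divr_gt0 ?mulr_gt0 ?exprn_gt0 //.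
by rewrite ltr_wpDl.
Qed.

(** * Positivity and linearity of the partial trace, and its duality with B (x) I *)

Lemma sum_mxtens m n (F : 'I_(m * n) -> C) :
  \sum_x F x = \sum_(i < m) \sum_(k < n) F (mxtens_index (i, k)).
Proof.
rewrite pair_big /= (reindex (@mxtens_index m n)) /=.
  by apply: eq_bigr => -[].
by exists (@mxtens_unindex m n) => ? _; rewrite ?mxtens_indexK ?mxtens_unindexK.
Qed.

(** The form of the partial trace at u is the sum over basis vectors e_k of the form of A at u (x)
    e_k, which is [w k] in the proof. *)
Lemma posdef_ptrace2 m n (A : 'M[C]_(m * n)) : (0 < n)%N ->
  posdef A -> posdef (ptrace2 A).
Proof.
move=> n0 pA u u0.
pose w k : 'cV[C]_(m * n) := \col_x (u (mxtens_unindex x).1 0 *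
  ((mxtens_unindex x).2 == k)%:R).
have -> : (u^t* *m ptrace2 A *m u) 0 0 = \sum_k ((w k)^t* *m A *m w k) 0 0.
  rewrite qformE; under [RHS]eq_bigr do rewrite qformE sum_mxtens.
  rewrite [RHS]exchange_big; apply: eq_bigr => i _ /=.
  under [RHS]eq_bigr => k _.
    rewrite (bigD1 k) //= [X in _ + X]big1 ?addr0; last first.
      move=> l /negPf lk; apply: big1 => y _.
      by rewrite mxE mxtens_indexK /= lk mulr0 rmorph0 !mul0r.
    rewrite sum_mxtens; over.
  rewrite [RHS]exchange_big; apply: eq_bigr => j _ /=.
  rewrite mxE mulr_sumr mulr_suml; apply: eq_bigr => k _.
  rewrite (bigD1 k) //= [X in _ + X]big1 ?addr0; last first.
    by move=> l /negPf lk; rewrite !mxE !mxtens_indexK /= lk !mulr0.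
  by rewrite !mxE !mxtens_indexK /= eqxx !mulr1.
have w0 k : w k != 0.
  apply: contra u0 => /eqP/matrixP wk; apply/eqP/matrixP => i j.
  have := wk (mxtens_index (i, k)) 0.
  by rewrite !mxE mxtens_indexK /= eqxx mulr1 ord1.
case: n n0 A pA w w0 => // n _ A pA w w0.
rewrite (bigD1 ord0) //= ltr_pwDl ?pA ?w0 // sumr_ge0 // => k _.
by rewrite ltW // pA // w0.
Qed.

Lemma ptrace2_trC m n (A : 'M[C]_(m * n)) : (ptrace2 A)^t* = ptrace2 (A^t*).
Proof.
apply/matrixP => i j; rewrite !mxE rmorph_sum; apply: eq_bigr => k _.
by rewrite !mxE.
Qed.

Lemma ptrace2_linear m n : linear (@ptrace2 C m n).
Proof.
move=> a A B; apply/matrixP => i j; rewrite !mxE mulr_sumr -big_split.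
by apply: eq_bigr => k _; rewrite !mxE.
Qed.

(** With this structure [mxcvg_linear] and [mxder_linear] apply to the partial trace. *)
HB.instance Definition _ m n :=
  GRing.isLinear.Build C 'M[C]_(m * n) 'M[C]_m _ (@ptrace2 C m n)
    (@ptrace2_linear m n).

Lemma ptrace2Z m n a (A : 'M[C]_(m * n)) : ptrace2 (a *: A) = a *: ptrace2 A.
Proof. exact: linearZ. Qed.

(** For the trace pairing, the partial trace is dual to B -> B (x) I; this rewrites the terms of the
    reverse divergence. *)
Lemma mxtrace_tens1 m n (A : 'M[C]_(m * n)) (B : 'M[C]_m) :
  \tr (A *m (B *t (1%:M : 'M[C]_n))) = \tr (ptrace2 A *m B).
Proof.
rewrite /mxtrace sum_mxtens; apply: eq_bigr => i _.
under eq_bigr do rewrite mxE sum_mxtens.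
rewrite exchange_big mxE; apply: eq_bigr => j _ /=.
rewrite mxE mulr_suml; apply: eq_bigr => k _.
rewrite (bigD1 k) //= [X in _ + X]big1 ?addr0 => [|l /negPf lk].
  by rewrite tensmxE mxE eqxx mulr1.
by rewrite tensmxE mxE lk !mulr0.
Qed.

End PositiveMatrices.

(** * Positivity of the exponential and traces of exponential expansions *)

Section VisibleState.
Context {R : realType}.
Local Notation C := (Cx R).
Local Open Scope sesquilinear_scope.

(** e^X is the Gram matrix of e^(X/2), which is Hermitian and invertible. *)
Lemma posdef_expm n (X : 'M[C]_n) : X^t* = X -> posdef (expm X).
Proof.
move=> XC; set B := expm (2^-1 *: X).
have BC : B^t* = B.
  rewrite expm_trC; congr expm; apply/matrixP => i j.
  have := congr1 (fun M : 'M[C]_n => M i j) XC; rewrite !mxE => XCij.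
  by rewrite rmorphM /= XCij conj_Creal // rpredV realn.
have -> : expm X = B^t* *m B.
  rewrite BC -expm_scaleD; congr expm.
  by rewrite -[LHS]scale1r; congr (_ *: _); field.
by apply: unit_posdef_gram; apply: expm_unit.
Qed.

Lemma mxcvg_trace n (u : nat -> 'M[C]_n) (A : 'M[C]_n) :
  mxcvg \oo u A -> (fun N => \tr (u N)) @ \oo --> (\tr A : C).
Proof.
move=> uA; apply/cvgrPdist_lt => e e0.
have e_real : e = (complex.Re e)%:C by rewrite RRe_real ?gtr0_real.
have e1 : 0 < complex.Re e by rewrite -ltcR -e_real.
move/cvgrPdist_lt : uA => /(_ _ e1); apply: filterS => N.
rewrite sub0r normrN ger0_norm ?mxnorm1_ge0 // => ue.
rewrite e_real -cabsE ltcR; apply: le_lt_trans ue.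
by rewrite -[_ - _]opprB cabsN -raddfB; apply: cabs_mxtrace_le.
Qed.

(** The exponent - H moves in the direction - dH, whereas the series of the theorem is in + dH. *)
Lemma mxcvg_adN n (X V : 'M[C]_n) Phi : mxcvg \oo (series (ad_term X V)) Phi ->
  mxcvg \oo (series (ad_term X (- V))) (- Phi).
Proof.
move=> cPhi; have : mxcvg \oo (fun N => - series (ad_term X V) N) (- Phi).
  exact: mxcvgN.
congr (mxcvg _ _ _); apply/funext => N; rewrite /series /= -sumrN.
apply: eq_bigr => p _; rewrite /ad_term -scalerN; congr (_ *: _).
elim: p => [//|p IH]; rewrite !iterS -IH /Ad.
by rewrite mulmxN mulNmx opprB opprK addrC.
Qed.

(** By cyclicity tr([X, Y] E) = tr(Y [E, X]), and E commutes with X. *)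
Lemma mxtrace_comm_ad n (X V E : 'M[C]_n) p : E *m X = X *m E ->
  \tr (iter p.+1 (Ad X) V *m E) = 0.
Proof.
move=> EX; rewrite iterS /Ad mulmxBl raddfB /=; set Y := iter p _ _.
by rewrite -(mulmxA Y) -EX mulmxA (mxtrace_mulC _ X) mulmxA subrr.
Qed.

(** Under the trace against e^X only the p = 0 term of the series survives. *)
Lemma mxtrace_ad_expm n (X V Phi : 'M[C]_n) : mxcvg \oo (series (ad_term X V)) Phi ->
  \tr (Phi *m expm X) = \tr (V *m expm X).
Proof.
move=> cPhi.
have h : mxcvg \oo (fun N => series (ad_term X V) N.+1 *m expm X) (Phi *m expm X).
  by apply: mxcvgM; [apply: mxcvg_shiftS|apply: mxcvg_cst].
have := mxcvg_trace h.
have -> : (fun N => \tr (series (ad_term X V) N.+1 *m expm X)) =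
    (fun=> \tr (V *m expm X)).
  apply/funext => N; rewrite /series /= big_nat_recl // mulmxDl raddfD /=.
  rewrite mulmx_suml raddf_sum big1 ?addr0 => [|p _].
    by rewrite /ad_term /= invr1 scale1r.
  rewrite /ad_term /= -scalemxAl mxtraceZ mxtrace_comm_ad ?mulr0 //.
  exact: expm_comm.
move=> cst_cvg; apply: (@cvg_unique C (@norm_hausdorff C C) _ _ _ _ cst_cvg).
exact: cvg_cst.
Qed.

Lemma Re_gt0 (z : C) : 0 < z -> 0 < complex.Re z.
Proof. by move=> z0; rewrite -ltcR RRe_real ?gtr0_real. Qed.

Lemma ln_ReM (z w : C) : 0 < z -> 0 < w ->
  ln (complex.Re (z * w)) = ln (complex.Re z) + ln (complex.Re w).
Proof.
move=> z0 w0; rewrite -[z in LHS]RRe_real ?gtr0_real // Re_realM.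
by rewrite lnM ?posrE ?Re_gt0.
Qed.

(** The divergences are real but the stated series are complex; the real derivative is therefore
    given together with its value in C. *)
Lemma mxder_ln_trace n (F : R -> 'M[C]_n) t D : (forall s, 0 < \tr (F s)) ->
  mxder F t D ->
  exists2 d : R, is_derive t 1 (fun s => ln (complex.Re (\tr (F s)))) d &
                 d%:C = \tr D / \tr (F t).
Proof.
move=> F0 dF; exists ((complex.Re (\tr (F t)))^-1 * complex.Re (\tr D)).
  by apply: is_derive1_comp (mxder_tr_Re dF); apply/is_derive1_ln/Re_gt0.
rewrite rmorphM fmorphV /= RRe_real ?gtr0_real // mulrC.
by rewrite (mxder_tr_real _ dF) // => s; rewrite gtr0_real.
Qed.

End VisibleState.

(** * The derivatives of the two divergences *)

Section RenyiDerivative.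
Context {R : realType}.
Local Notation C := (Cx R).
Local Open Scope sesquilinear_scope.
Variables (m n : nat) (m0 : (0 < m)%N) (n0 : (0 < n)%N).
Variables (H : R -> 'M[C]_(m * n)) (H_herm : forall t, H t \is hermsymmx).
Variables (rho : 'M[C]_m) (rho_density : density rho).

Let E t := expm (- H t).
Let P t := ptrace2 (E t).

Let HC t : (- H t)^t* = - H t.
Proof.
have /is_hermitianmxP := H_herm t; rewrite expr0 scale1r => {2}->.
by apply/matrixP => i j; rewrite !mxE rmorphN.
Qed.

Let E_posdef t : posdef (E t).
Proof. exact: posdef_expm. Qed.

Let P_posdef t : posdef (P t).
Proof. exact: posdef_ptrace2. Qed.

Let P_unit t : P t \in unitmx.
Proof. exact: posdef_unit. Qed.

Let PC t : (P t)^t* = P t.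
Proof. by rewrite ptrace2_trC expm_trC HC. Qed.

Let Z_gt0 t : 0 < \tr (E t).
Proof. by apply: posdef_trace_gt0 => //; rewrite muln_gt0 m0. Qed.

Let stateE t : visible_state (H t) = (\tr (E t))^-1 *: P t.
Proof. exact: linearZ. Qed.

Let inv_stateE t : invmx (visible_state (H t)) = \tr (E t) *: invmx (P t).
Proof.
by rewrite stateE invmxZ ?invrK // -stateE stateE unitmxZ // unitfE invr_eq0 gt_eqF.
Qed.

Let rho_neq0 : rho != 0.
Proof.
apply/eqP => r0; have [_] := rho_density; rewrite r0 raddf0 => /eqP.
by rewrite eq_sym oner_eq0.
Qed.

Let rhoC : rho^t* = rho.
Proof. by apply: psdmx_trC; case: rho_density. Qed.

Let G t := rho *m rho *m invmx (P t).

(** Cyclicity turns this into the trace of rho P^-1 rho, with rho Hermitian and nonzero. *)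
Let G_gt0 t : 0 < \tr (G t).
Proof.
rewrite /G -mulmxA mxtrace_mulC -{1}rhoC.
by apply: posdef_trace => //; apply: posdef_invmx.
Qed.

Let K t := P t *m P t *m invmx rho.

(** Likewise the trace of P rho^-1 P, where the invertible rho is positive definite. *)
Let K_gt0 t : rho \in unitmx -> 0 < \tr (K t).
Proof.
move=> ru; rewrite /K -mulmxA mxtrace_mulC -{1}(PC t).
apply: posdef_trace; last first.
  apply/eqP => P0; have := posdef_trace_gt0 m0 (@P_posdef t).
  by rewrite P0 raddf0 ltxx.
by apply: posdef_invmx; apply: psdmx_unit_posdef => //; case: rho_density.
Qed.

Let renyi_rho_state t : renyi2 rho (visible_state (H t)) =
  ln (complex.Re (\tr (E t))) + ln (complex.Re (\tr (G t))).
Proof. by rewrite /renyi2 inv_stateE -scalemxAr mxtraceZ ln_ReM ?Z_gt0 ?G_gt0. Qed.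

Let tr_stateE t : \tr (visible_state (H t) *m visible_state (H t) *m invmx rho) =
  \tr (K t) / \tr (E t) ^+ 2.
Proof.
rewrite stateE -!scalemxAl -scalemxAr -scalemxAl !mxtraceZ mulrA -invfM -expr2.
by rewrite mulrC.
Qed.

Let renyi_state_rho t : rho \in unitmx -> renyi2 (visible_state (H t)) rho =
  ln (complex.Re (\tr (K t))) - (ln (complex.Re (\tr (E t))) *+ 2).
Proof.
move=> ru; have k0 := K_gt0 t ru; have z0 := Z_gt0 t.
have kE : \tr (K t) = \tr (K t) / \tr (E t) ^+ 2 * (\tr (E t) * \tr (E t)).
  by rewrite -expr2 divfK // expf_neq0 // gt_eqF.
have q0 : 0 < \tr (K t) / \tr (E t) ^+ 2 by rewrite divr_gt0 ?exprn_gt0.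
rewrite [in RHS]kE (ln_ReM q0 (mulr_gt0 z0 z0)) (ln_ReM z0 z0) -mulr2n addrK.
by rewrite /renyi2 tr_stateE.
Qed.

Variables (theta : R) (dH : 'M[C]_(m * n)) (H_diff : mxder H theta dH).

Let X := - H theta.
Let Z := \tr (E theta).
Let s := visible_state (H theta).

Lemma renyi2_rho_state_derive :
  let T1 := fun p : nat =>
    \tr (rho *m rho *m invmx s *m
         ptrace2 (iter p (Ad X) dH *m E theta) *m invmx s)
    / (\tr (rho *m rho *m invmx s) * Z * (p.+1)`!%:R) in
  [/\ derivable (fun t => renyi2 rho (visible_state (H t))) theta 1,
      cvgn (series T1) &
      ('D_1 (fun t => renyi2 rho (visible_state (H t))) theta : R)%:C
      = limn (series T1) - \tr (dH *m E theta) / Z].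
Proof.
move=> T1.
have [Phi cPhi] := mxcvg_ad X dH.
have dX : mxder (fun t => - H t) theta (- dH) by apply: mxderN.
have dE : mxder E theta (- (Phi *m E theta)).
  by rewrite -mulNmx; apply: mxder_expm dX _; apply: mxcvg_adN.
have dP : mxder P theta (- ptrace2 (Phi *m E theta)).
  by rewrite -linearN; apply: mxder_linear.
set Y := ptrace2 (Phi *m E theta) in dP.
(* The sign from differentiating an inverse cancels the sign of [dP]. *)
have dG : mxder G theta (rho *m rho *m (invmx (P theta) *m Y *m invmx (P theta))).
  apply: (mxder_linear (mulmx (rho *m rho))).
  by have := mxder_invmx P_unit dP; rewrite mulmxN mulNmx opprK.
have [dz dz1 dzE] := mxder_ln_trace Z_gt0 dE.
have [dg dg1 dgE] := mxder_ln_trace G_gt0 dG.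
have D : is_derive theta 1 (fun t => renyi2 rho (visible_state (H t))) (dz + dg).
  have -> : (fun t => renyi2 rho (visible_state (H t))) =
      (fun t => ln (complex.Re (\tr (E t)))) + (fun t => ln (complex.Re (\tr (G t)))).
    by apply/funext => t; rewrite renyi_rho_state.
  exact: is_deriveD.
pose c := \tr (rho *m rho *m invmx s).
have cE : c = Z * \tr (G theta) by rewrite /c inv_stateE -scalemxAr mxtraceZ.
(* The partial sums are a fixed linear image of those of [ad_term], so they inherit its
   convergence. *)
have cT1 : series T1 @ \oo -->
    (\tr (rho *m rho *m invmx s *m Y *m invmx s) / (c * Z) : C).
  have -> : series T1 = (fun N => \tr (rho *m rho *m invmx s *m
      ptrace2 (series (ad_term X dH) N *m E theta) *m invmx s) / (c * Z)).
    apply/funext => N; rewrite /series /= mulmx_suml linear_sum mulmx_sumr.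
    rewrite mulmx_suml raddf_sum mulr_suml; apply: eq_bigr => p _.
    rewrite /T1 /ad_term /= -scalemxAl ptrace2Z -scalemxAr -scalemxAl mxtraceZ.
    by rewrite -/c invfM [LHS]mulrA [LHS]mulrC -[RHS]mulrA.
  apply: cvgMl; apply: mxcvg_trace; apply: mxcvgM; last exact: mxcvg_cst.
  apply: mxcvgM; first exact: mxcvg_cst.
  by apply: mxcvg_linear; apply: mxcvgM => //; apply: mxcvg_cst.
split; [exact: ex_derive|exact: cvgP cT1|].
rewrite derive_val (cvg_lim (@norm_hausdorff C C) cT1) rmorphD /= dzE dgE.
rewrite raddfN /= (mxtrace_ad_expm cPhi) mulNr addrC; congr (_ - _).
(* The two inverse states contribute Z^2, and so does c Z = Z^2 tr G; what remains is the
   logarithmic derivative of tr G. *)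
rewrite cE inv_stateE -!(scalemxAl, scalemxAr) !mxtraceZ.
have z0 : Z != 0 by rewrite gt_eqF ?Z_gt0.
have g0 : \tr (G theta) != 0 by rewrite gt_eqF ?G_gt0.
by rewrite !mulmxA -/Z; field; rewrite z0 g0.
Qed.

Lemma renyi2_state_rho_derive : rho \in unitmx ->
  let T2 := fun p : nat =>
    \tr (iter p (Ad X) dH *m E theta *m
         (anticomm s (invmx rho) *t (1%:M : 'M[C]_n)))
    / (\tr (s *m s *m invmx rho) * Z * (p.+1)`!%:R) in
  [/\ derivable (fun t => renyi2 (visible_state (H t)) rho) theta 1,
      cvgn (series T2) &
      ('D_1 (fun t => renyi2 (visible_state (H t)) rho) theta : R)%:C
      = - limn (series T2) + 2 * (\tr (dH *m E theta) / Z)].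
Proof.
move=> ru T2.
have [Phi cPhi] := mxcvg_ad X dH.
have dX : mxder (fun t => - H t) theta (- dH) by apply: mxderN.
have dE : mxder E theta (- (Phi *m E theta)).
  by rewrite -mulNmx; apply: mxder_expm dX _; apply: mxcvg_adN.
have dP : mxder P theta (- ptrace2 (Phi *m E theta)).
  by rewrite -linearN; apply: mxder_linear.
set Y := ptrace2 (Phi *m E theta) in dP.
have dK : mxder K theta ((- Y *m P theta + P theta *m - Y) *m invmx rho).
  by apply: (mxder_linear (mulmxr (invmx rho))); apply: mxderM.
have [dz dz1 dzE] := mxder_ln_trace Z_gt0 dE.
have [dk dk1 dkE] := mxder_ln_trace (fun t => K_gt0 t ru) dK.
have D : is_derive theta 1 (fun t => renyi2 (visible_state (H t)) rho) (dk - dz *+ 2).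
  have -> : (fun t => renyi2 (visible_state (H t)) rho) =
      (fun t => ln (complex.Re (\tr (K t)))) -
      ((fun t => ln (complex.Re (\tr (E t)))) + (fun t => ln (complex.Re (\tr (E t))))).
    by apply/funext => t; rewrite renyi_state_rho.
  by apply: is_deriveB => //; rewrite mulr2n; apply: is_deriveD.
pose c := \tr (s *m s *m invmx rho).
have cE : c = \tr (K theta) / Z ^+ 2 by rewrite /c tr_stateE.
have cT2 : series T2 @ \oo --> (\tr (Y *m anticomm s (invmx rho)) / (c * Z) : C).
  have -> : series T2 = (fun N => \tr (ptrace2 (series (ad_term X dH) N *m E theta)
      *m anticomm s (invmx rho)) / (c * Z)).
    apply/funext => N; rewrite /series /= mulmx_suml linear_sum.
    rewrite mulmx_suml raddf_sum mulr_suml; apply: eq_bigr => p _.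
    rewrite /T2 mxtrace_tens1 /ad_term /= -scalemxAl ptrace2Z -scalemxAl mxtraceZ.
    by rewrite -/c invfM [LHS]mulrA [LHS]mulrC -[RHS]mulrA.
  apply: cvgMl; apply: mxcvg_trace; apply: mxcvgM; last exact: mxcvg_cst.
  by apply: mxcvg_linear; apply: mxcvgM => //; apply: mxcvg_cst.
split; [exact: ex_derive|exact: cvgP cT2|].
have dzZ : dz%:C = - (\tr (dH *m E theta) / Z).
  by rewrite dzE raddfN /= (mxtrace_ad_expm cPhi) mulNr.
rewrite derive_val (cvg_lim (@norm_hausdorff C C) cT2) rmorphB rmorphMn /= dzZ dkE.
rewrite mulNrn opprK mulr_natl; congr (_ + _).
(* Cyclicity moves Y to the front of both terms, so that P and rho^-1 form an anticommutator. *)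
have -> : \tr ((- Y *m P theta + P theta *m - Y) *m invmx rho) =
    - \tr (Y *m anticomm (P theta) (invmx rho)).
  rewrite mulNmx mulmxN -opprD mulNmx raddfN /= /anticomm mulmxDl mulmxDr !mxtraceD.
  by congr (- (_ + _)); rewrite ?mulmxA // -mulmxA mxtrace_mulC.
have -> : anticomm s (invmx rho) = Z^-1 *: anticomm (P theta) (invmx rho).
  by rewrite /s stateE /anticomm -scalemxAl -scalemxAr scalerDr.
(* The factor 1/Z from the anticommutator cancels against c Z = tr K / Z. *)
rewrite cE -scalemxAr mxtraceZ.
have z0 : Z != 0 by rewrite gt_eqF ?Z_gt0.
have k0 : \tr (K theta) != 0 by rewrite gt_eqF ?K_gt0.
by field; rewrite z0 k0.
Qed.

End RenyiDerivative.

Unset Implicit Arguments.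
Theorem theorem2p2 (R : realType) (nv nh : nat)
    (H : R -> 'M[Cx R]_(2 ^ nv * 2 ^ nh))
    (H_herm : forall t, H t \is hermsymmx)
    (H_diff : forall t, mxderivable H t)
    (rho : 'M[Cx R]_(2 ^ nv)) (rho_density : density rho) (theta : R) :
  let dH := mxderive H theta in
  let E := expm (- H theta) in
  let Z := \tr E in
  let sigma := fun t : R => visible_state (H t) in
  let s := sigma theta in
  let T1 := fun p : nat =>
    \tr (rho *m rho *m invmx s *m
         ptrace2 (iter p (Ad (- H theta)) dH *m E) *m invmx s)
    / (\tr (rho *m rho *m invmx s) * Z * (p.+1)`!%:R) in
  let T2 := fun p : nat =>
    \tr (iter p (Ad (- H theta)) dH *m E *m
         (anticomm s (invmx rho) *t (1%:M : 'M[Cx R]_(2 ^ nh))))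
    / (\tr (s *m s *m invmx rho) * Z * (p.+1)`!%:R) in
  [/\ derivable (fun t => renyi2 rho (sigma t)) theta 1,
      cvgn (series T1) &
      ('D_1 (fun t => renyi2 rho (sigma t)) theta : R)%:C
      = limn (series T1) - \tr (dH *m E) / Z]
  /\
  (rho \in unitmx ->
   [/\ derivable (fun t => renyi2 (sigma t) rho) theta 1,
       cvgn (series T2) &
       ('D_1 (fun t => renyi2 (sigma t) rho) theta : R)%:C
       = - limn (series T2) + 2 * (\tr (dH *m E) / Z)]).
Proof.
have n_gt0 k : (0 < 2 ^ k)%N by rewrite expn_gt0.
have dH := mxderivable_mxder (H_diff theta).
split.
  exact: (renyi2_rho_state_derive (n_gt0 nv) (n_gt0 nh) H_herm rho_density dH).
exact: (renyi2_state_rho_derive (n_gt0 nv) (n_gt0 nh) H_herm rho_density dH).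
Qed.
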